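(* For the class of all finite simple undirected graphs, computing a $\beta$-optimal linear arrangement and computing a $\beta$-optimal linear reassembling are polynomial-time reducible to each other: there is a polynomial-time algorithm which, given $G$ and access to a procedure returning a $\beta$-optimal linear reassembling [resp. $\beta$-optimal linear arrangement] of any finite simple undirected graph, outputs a $\beta$-optimal linear arrangement [resp. $\beta$-optimal linear reassembling] of $G$.
   Context: Let $G=(V,E)$, $n=|V|$. For $X\subseteq V$, $\deg_G(X)$ is the number of edges with exactly one endpoint in $X$. A linear binary tree over $V$ is a collection $\mathcal{L}=\{\{v_j\}\mid 1\le j\le n\}\cup\{\{v_1,\dots,v_k\}\mid 2\le k\le n\}$ for some enumeration $v_1,\dots,v_n$ of $V$; $(G,\mathcal{L})$ is a linear reassembling with $\beta(G,\mathcal{L})=\sum_{X\in\mathcal{L}}\deg_G(X)$; it is $\beta$-optimal if this is minimal among all linear reassemblings of $G$. A linear arrangement is a bijection $\varphi:V\to\{1,\dots,n\}$ with $\beta(G,\varphi)=\sum_{i=1}^n\deg_G(\{v\mid\varphi(v)\le i\})$ (equal to $\sum_{\{v,w\}\in E}|\varphi(v)-\varphi(w)|$); it is $\beta$-optimal (minimum-cost) if this is minimal among all linear arrangements of $G$. *)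

(* Defs.v *)
From mathcomp Require Import all_boot.

Set Implicit Arguments.
Unset Strict Implicit.
Unset Printing Implicit Defensive.

(** * Graphs, linear arrangements, linear reassemblings *)

Record sgraph (V : finType) := SGraph {
  edges : {set {set V}};
  edgesP : [forall e in edges, #|e| == 2]
}.

Section Graphs.
Variable V : finType.
Implicit Types (G : sgraph V) (X : {set V}) (L : {set {set V}}).

Definition deg G X : nat := #|[set e in edges G | #|e :&: X| == 1]|.

Definition linear_arrangement (phi : V -> nat) : Prop :=
  [/\ injective phi,
      forall v, 1 <= phi v <= #|V|
    & forall i, 1 <= i <= #|V| -> exists v, phi v = i].

Definition beta_arrangement G (phi : V -> nat) : nat :=
  \sum_(1 <= i < #|V|.+1) deg G [set v | phi v <= i].

Definition optimal_arrangement G (phi : V -> nat) : Prop :=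
  linear_arrangement phi /\
  forall psi, linear_arrangement psi ->
    beta_arrangement G phi <= beta_arrangement G psi.

Definition enumeration (s : seq V) : Prop := uniq s /\ forall v, v \in s.

Definition linear_tree (s : seq V) : {set {set V}} :=
  [set [set v] | v in s]
  :|: [set [set v in take k s] | k : 'I_#|V|.+1 & 2 <= k].

Definition linear_binary_tree L : Prop :=
  exists2 s, enumeration s & L = linear_tree s.

Definition beta_reassembling G L : nat := \sum_(X in L) deg G X.

Definition optimal_reassembling G L : Prop :=
  linear_binary_tree L /\
  forall L', linear_binary_tree L' ->
    beta_reassembling G L <= beta_reassembling G L'.

End Graphs.

(** * Oracle programs with a running time

   The machine model is a random access machine with structured control and an
   oracle instruction.  The memory consists of number variables and of
   two-dimensional number tables, which are addressed by computed indices.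
   Addition and truncated subtraction have unit cost and there is no
   multiplication, so the bit length of a number grows by at most a constant
   per time unit, and running times are polynomially related to those of
   oracle Turing machines. *)

Definition table := nat -> nat -> nat.

Inductive expr :=
  | Cst of nat
  | Var of nat
  | Get of nat & expr & expr  (* entry of a table *)
  | EAdd of expr & expr
  | ESub of expr & expr.

Inductive cmd :=
  | Skip
  | Seq of cmd & cmd
  | Assign of nat & expr
  | Put of nat & expr & expr & expr
  | If of expr & cmd & cmd
  | While of expr & cmd
  | Call of nat & nat & nat.

Record state := State { vars : nat -> nat; tabs : nat -> table }.

Definition set_var (s : state) (x m : nat) : state :=
  State (fun y => if y == x then m else vars s y) (tabs s).

Definition set_tab (s : state) (a : nat) (M : table) : state :=
  State (vars s) (fun b => if b == a then M else tabs s b).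

Definition set_entry (M : table) (i j m : nat) : table :=
  fun k l => if (k == i) && (l == j) then m else M k l.

Fixpoint eval (s : state) (e : expr) : nat :=
  match e with
  | Cst m => m
  | Var x => vars s x
  | Get a e1 e2 => tabs s a (eval s e1) (eval s e2)
  | EAdd e1 e2 => eval s e1 + eval s e2
  | ESub e1 e2 => eval s e1 - eval s e2
  end.

Fixpoint ecost (e : expr) : nat :=
  match e with
  | Cst _ | Var _ => 1
  | Get _ e1 e2 | EAdd e1 e2 | ESub e1 e2 => (ecost e1 + ecost e2).+1
  end.

Definition encodes_graph n (G : sgraph 'I_n) (M : table) : Prop :=
  forall i j : 'I_n, M i j = ([set i; j] \in edges G) :> nat.

(** An oracle receives a graph and returns the raw contents of a table. *)
Definition oracle := forall n, sgraph 'I_n -> table.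

(** [exec O c s t s']: run from [s], the program [c] halts in [s'] after [t]
   time units.  [Call x a b] submits to the oracle the graph whose order is the
   value of variable [x] and whose adjacency matrix is table [a], and stores the
   answer in table [b].  It is charged the size of the adjacency matrix, and it
   is stuck if table [a] does not hold the adjacency matrix of a simple graph
   of that order. *)
Inductive exec (O : oracle) : cmd -> state -> nat -> state -> Prop :=
  | ExecSkip s : exec O Skip s 1 s
  | ExecSeq c1 c2 s1 s2 s3 t1 t2 :
      exec O c1 s1 t1 s2 -> exec O c2 s2 t2 s3 ->
      exec O (Seq c1 c2) s1 (t1 + t2).+1 s3
  | ExecAssign x e s :
      exec O (Assign x e) s (ecost e).+1 (set_var s x (eval s e))
  | ExecPut a e1 e2 e s :
      exec O (Put a e1 e2 e) s (ecost e1 + ecost e2 + ecost e).+1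
        (set_tab s a (set_entry (tabs s a) (eval s e1) (eval s e2) (eval s e)))
  | ExecIfTrue e c1 c2 s t s' :
      eval s e != 0 -> exec O c1 s t s' ->
      exec O (If e c1 c2) s (ecost e + t).+1 s'
  | ExecIfFalse e c1 c2 s t s' :
      eval s e = 0 -> exec O c2 s t s' ->
      exec O (If e c1 c2) s (ecost e + t).+1 s'
  | ExecWhileTrue e c s1 t1 s2 t2 s3 :
      eval s1 e != 0 -> exec O c s1 t1 s2 -> exec O (While e c) s2 t2 s3 ->
      exec O (While e c) s1 (ecost e + t1 + t2).+1 s3
  | ExecWhileFalse e c s :
      eval s e = 0 -> exec O (While e c) s (ecost e).+1 s
  | ExecCall x a b s (H : sgraph 'I_(vars s x)) :
      encodes_graph H (tabs s a) ->
      exec O (Call x a b) s (vars s x * vars s x).+1 (set_tab s b (O _ H)).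

Lemma encodes_graph_inj n (G H : sgraph 'I_n) (M : table) :
  encodes_graph G M -> encodes_graph H M -> G = H.
Proof.
case: G H => [E EP] [F FP] /= hG hH.
have EF : E = F.
  apply/setP => e; have [/cards2P[i [j [_ ->]]]|ne2] := boolP (#|e| == 2).
    by have := hG i j; rewrite hH /=; case: (_ \in F); case: (_ \in E).
  have -> : (e \in E) = false.
    by apply: contraNF ne2 => eE; exact: (forall_inP EP).
  by apply/esym; apply: contraNF ne2 => eF; exact: (forall_inP FP).
by subst F; rewrite (bool_irrelevance EP FP).
Qed.

Lemma exec_deterministic O c s t1 s1 t2 s2 :
  exec O c s t1 s1 -> exec O c s t2 s2 -> t1 = t2 /\ s1 = s2.
Proof.
move=> h1; elim: h1 t2 s2 => {c s t1 s1}.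
- by move=> s t2 s2 h; inversion h.
- move=> c1 c2 s s' s'' t t' _ IH1 _ IH2 t2 s2 h.
  inversion h as [|? ? ? ? ? ? ? h1 h2| | | | | | |]; subst.
  by case: (IH1 _ _ h1) => ? ?; subst; case: (IH2 _ _ h2) => ? ?; subst.
- by move=> x e s t2 s2 h; inversion h.
- by move=> a e1 e2 e s t2 s2 h; inversion h.
- move=> e c1 c2 s t s' nz _ IH t2 s2 h.
  inversion h as [| | | |? ? ? ? ? ? _ h1|? ? ? ? ? ? z _| | |]; subst.
    by case: (IH _ _ h1) => ? ?; subst.
  by rewrite z in nz.
- move=> e c1 c2 s t s' z _ IH t2 s2 h.
  inversion h as [| | | |? ? ? ? ? ? nz _|? ? ? ? ? ? _ h1| | |]; subst.
    by rewrite z in nz.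
  by case: (IH _ _ h1) => ? ?; subst.
- move=> e c s t s' t' s'' nz _ IH1 _ IH2 t2 s2 h.
  inversion h as [| | | | | |? ? ? ? ? ? ? _ h1 h2|? ? ? z|]; subst.
    by case: (IH1 _ _ h1) => ? ?; subst; case: (IH2 _ _ h2) => ? ?; subst.
  by rewrite z in nz.
- move=> e c s z t2 s2 h.
  inversion h as [| | | | | |? ? ? ? ? ? ? nz _ _| |]; subst => //.
  by rewrite z in nz.
- move=> x a b s H hH t2 s2 h.
  inversion h as [| | | | | | | |? ? ? ? H' hH']; subst.
  by split=> //; rewrite (encodes_graph_inj hH hH').
Qed.

(** * Polynomial-time reducibility of search problems on graphs *)

(** [P n G M] means that the table [M] encodes a correct answer for [G]. *)
Definition problem := forall n, sgraph 'I_n -> table -> Prop.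

Definition solves (O : oracle) (P : problem) : Prop :=
  forall n (G : sgraph 'I_n), P n G (O n G).

(** The input is the order in variable 0 and the adjacency matrix in table 0;
   all other cells are 0.  The output is read from table 1. *)
Definition initial_state n (G : sgraph 'I_n) : state :=
  State
    (fun x => if x == 0 then n else 0)
    (fun a i j =>
       if a == 0 then
         [exists u : 'I_n, exists v : 'I_n,
            [&& val u == i, val v == j & [set u; v] \in edges G]] : nat
       else 0).

(** The program and the bound are uniform in the oracle and in the graph. *)
Definition poly_time_reducible (P Q : problem) : Prop :=
  exists (c : cmd) (k : nat),
  forall O : oracle, solves O Q ->
  forall n (G : sgraph 'I_n),
  exists (t : nat) (s : state),
    [/\ exec O c (initial_state G) t s, t <= k * n ^ k + k & P n G (tabs s 1)].

(** An arrangement is given by the list of its values, in row 0. *)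
Definition encodes_arrangement n (phi : 'I_n -> nat) (M : table) : Prop :=
  forall v : 'I_n, M 0 v = phi v.

(** A collection of vertex sets is given by the characteristic vectors of its
   members, one per row, in any order and without repetition. *)
Definition encodes_family n (L : {set {set 'I_n}}) (M : table) : Prop :=
  exists F : seq {set 'I_n},
    [/\ uniq F, F =i L
      & forall (i : nat) (v : 'I_n), i < size F ->
          M i v = (v \in nth set0 F i) :> nat].

Definition optimal_arrangement_problem : problem := fun n G M =>
  exists2 phi, optimal_arrangement G phi & encodes_arrangement phi M.

Definition optimal_reassembling_problem : problem := fun n G M =>
  exists2 L, optimal_reassembling G L & encodes_family L M.

(* Main.v *)
Require Import Defs.
From mathcomp Require Import all_boot.
From mathcomp Require Import zify.

Set Implicit Arguments.
Unset Strict Implicit.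
Unset Printing Implicit Defensive.

(** For the enumeration [v_1, ..., v_n] given by an arrangement [phi], the
   reassembling has cost [sum_v deg {v} + beta(phi) - deg {v_1}], so the two
   problems differ only by the reward [deg {v_1}] for the first vertex.

   Arrangement from reassembling: in the disjoint union of [G] and a clique
   [K_{n+1}] the reward is largest when the first vertex lies in the clique,
   and moving the clique to the front costs nothing; hence an optimal
   reassembling of the union starts in the clique and orders [G] optimally.
   The order is read off from the number of members containing each vertex.

   Reassembling from arrangement: for each vertex [a], take a clique [W] of
   size [(n+1)^3], join [a] to all of [W] and one vertex of [W] to all of [G].
   Splitting [W + a], or having vertices of [G - a] on both sides of it, costs
   at least [|W|], more than the whole rest of a sensible arrangement.  So in
   an optimal arrangement [G - a] lies on one side of [W + a], and ordering
   [V(G)] by the distance to [a] gives an optimal arrangement of [G] among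
   those starting at [a].  The best one over all [a] is an optimal
   reassembling. *)

(** * Arrangements, ranks and costs *)

(* [sgraph 'I_n] elaborates with a [reverse_coercion] that hides equal atoms
   from [lia]. *)
Ltac nlia := unfold reverse_coercion in *; simpl Finite.sort in *; lia.

(** Counts the levels [i] that separate the positions [p] and [q]; this turns sums of cut degrees
    into sums of edge lengths. *)
Lemma sum_leq_between n p q : 0 < p -> q <= n.+1 ->
  \sum_(1 <= i < n.+1) (p <= i < q) = q - p.
Proof.
move=> p0 qn; have -> : q - p = minn q n.+1 - p by rewrite (minn_idPl qn).
elim: n {qn} => [|n IH]; first by rewrite big_geq //; lia.
by rewrite big_nat_recr //= IH; lia.
Qed.

Lemma sum_leq_below n k : k <= n -> \sum_(1 <= i < n.+1) (i <= k) = k.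
Proof.
move=> kn; rewrite -[RHS](subn0 k) -subSS -(@sum_leq_between n 1 k.+1) //.
by apply: eq_big_nat => i /andP[-> _].
Qed.

Section Arrangements.
Variable T : finType.
Implicit Types (f phi : T -> nat) (w : T -> T -> nat).

Definition rank f v := #|[set u | f u <= f v]|.

(** Subtraction is truncated, so for symmetric [w] each unordered pair contributes its weight times
    its distance exactly once. *)
Definition stretch w f := \sum_u \sum_v w u v * (f v - f u).

Definition prefix_set f k : {set T} := [set v | f v <= k].

Definition tree_of f : {set {set T}} :=
  [set [set v] | v : T] :|: [set prefix_set f k | k : 'I_#|T|.+1 & 2 <= k].

Lemma inj_linear_arrangement phi :
  injective phi -> (forall v, 1 <= phi v <= #|T|) -> linear_arrangement phi.
Proof.
move=> phiI phiB; split=> // i iB.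
have u : uniq (map phi (enum T)) by rewrite map_inj_uniq ?enum_uniq.
have sub : {subset map phi (enum T) <= iota 1 #|T|}.
  by move=> _ /mapP[v _ ->]; rewrite mem_iota; have := phiB v; lia.
have [|_ e] := uniq_min_size u sub.
  by rewrite size_iota size_map -cardE.
have : i \in map phi (enum T) by rewrite e mem_iota; lia.
by case/mapP=> v _ ->; exists v.
Qed.

Lemma linear_arrangement_perm phi : linear_arrangement phi ->
  perm_eq (map phi (enum T)) (iota 1 #|T|).
Proof.
move=> [phiI phiB phiS]; apply: uniq_perm.
- by rewrite map_inj_uniq ?enum_uniq.
- exact: iota_uniq.
move=> i; rewrite mem_iota; apply/mapP/idP => [[v _ ->]|iB].
  by have := phiB v; lia.
by have [|v <-] := phiS i; [lia|exists v; rewrite ?mem_enum].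
Qed.

Lemma sum_linear_arrangement phi (F : nat -> nat) : linear_arrangement phi ->
  \sum_v F (phi v) = \sum_(1 <= i < #|T|.+1) F i.
Proof.
move=> /linear_arrangement_perm phiP.
rewrite /index_iota subSS subn0 -(perm_big _ phiP) /= big_map big_enum.
by [].
Qed.

Lemma rankE f v : rank f v = \sum_u (f u <= f v).
Proof.
rewrite /rank -sum1_card big_mkcond /=.
by apply: eq_bigr => u _; rewrite inE; case: leq.
Qed.

Lemma leq_rank f u v : (rank f u <= rank f v) = (f u <= f v).
Proof.
apply/idP/idP => [|le_uv]; last first.
  by apply/subset_leq_card/subsetP => x; rewrite !inE => /leq_trans; apply.
apply: contraTT; rewrite -!ltnNge => lt_vu.
apply/proper_card/properP; split; last by exists u; rewrite inE // -ltnNge.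
by apply/subsetP => x; rewrite !inE; lia.
Qed.

Lemma rank_linear_arrangement f : injective f -> linear_arrangement (rank f).
Proof.
move=> fI; apply: inj_linear_arrangement => [u v e|v].
  by apply: fI; apply/eqP; rewrite eqn_leq -!(leq_rank f) e leqnn.
by rewrite max_card andbT card_gt0; apply/set0Pn; exists v; rewrite inE.
Qed.

Lemma card_prefix_set phi k : linear_arrangement phi -> k <= #|T| ->
  #|prefix_set phi k| = k.
Proof.
move=> phiA kT; rewrite -sum1_card big_mkcond /=.
under eq_bigr => v _ do rewrite inE.
have /= -> := @sum_linear_arrangement phi (fun i => if i <= k then 1 else 0) phiA.
rewrite -[RHS](sum_leq_below kT).
by apply: eq_bigr => i _; case: leq.
Qed.

Lemma rank_id phi v : linear_arrangement phi -> rank phi v = phi v.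
Proof.
by move=> phiA; apply: card_prefix_set => //; case: phiA => _ /(_ v)/andP[].
Qed.

Lemma eq_rank f g : (forall u v, (f u <= f v) = (g u <= g v)) ->
  rank f =1 rank g.
Proof. by move=> e v; apply: eq_card => u; rewrite !inE e. Qed.

(** For [f u <= f v], the difference of ranks counts the points with value above [f u] and at most
    [f v]. These values are distinct integers of that interval, and a skipped value [c] inside it is
    one more. *)
Lemma rank_dist_gap f c u v : injective f ->
  rank f v - rank f u + ((f u < c < f v) && (c \notin codom f)) <= f v - f u.
Proof.
move=> fI; have [le_uv|lt_vu] := leqP (f u) (f v); last first.
  by have := leq_rank f v u; lia.
pose s := [seq f x | x <- enum [set x | f u < f x <= f v]].
have us : uniq s by rewrite map_inj_uniq ?enum_uniq.
have ss : size s = rank f v - rank f u.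
  rewrite size_map -cardE /rank -cardsDS; last first.
    by apply/subsetP => x; rewrite !inE => /leq_trans; apply.
  by apply: eq_card => x; rewrite !inE -ltnNge.
have subs : {subset s <= iota (f u).+1 (f v - f u)}.
  by move=> _ /mapP[x + ->]; rewrite mem_enum inE mem_iota; lia.
rewrite -ss; have [/andP[cuv cf]|_] := boolP (_ && _); last first.
  by rewrite addn0 -[X in _ <= X](size_iota (f u).+1); apply: uniq_leq_size.
rewrite addn1 -[X in _ <= X](size_iota (f u).+1).
apply: (@uniq_leq_size _ (c :: s)) => [|x].
  rewrite /= us andbT; apply: contra cf => /mapP[x _ ->]; exact: codom_f.
rewrite inE => /orP[/eqP->|/subs //]; rewrite mem_iota; lia.
Qed.

Lemma rank_dist f u v : injective f -> rank f v - rank f u <= f v - f u.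
Proof. by move=> fI; have := rank_dist_gap 0 u v fI; lia. Qed.

Lemma stretch_rank w f : injective f -> stretch w (rank f) <= stretch w f.
Proof.
move=> fI; apply: leq_sum => u _; apply: leq_sum => v _.
by rewrite leq_mul2l rank_dist ?orbT.
Qed.

Lemma linear_arrangement_first phi : linear_arrangement phi -> 0 < #|T| ->
  exists v, phi v = 1.
Proof. by case=> _ _ phiS T0; apply: phiS. Qed.

(** Prefixes with [2 <= k] differ from singletons and from each other in cardinality, so no two
    members of the family collapse and the sum over the set splits. *)
Lemma sum_tree_of phi (F : {set T} -> nat) : linear_arrangement phi ->
  \sum_(X in tree_of phi) F X =
  \sum_v F [set v] + \sum_(2 <= k < #|T|.+1) F (prefix_set phi k).
Proof.
move=> phiA; pose A := [set [set v] | v : T].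
pose B := [set prefix_set phi k | k : 'I_#|T|.+1 & 2 <= k].
rewrite (eq_bigl [predU A & B]) => [|X]; last by rewrite !inE.
rewrite bigU /=; last first.
  rewrite -setI_eq0; apply/eqP/setP => X; rewrite !inE.
  apply/negP => /andP[/imsetP[v _ ->] /imsetP[k]]; rewrite inE => k2 e.
  have := congr1 (fun C : {set T} => #|C|) e.
  by rewrite cards1 card_prefix_set -1?ltnS //; lia.
congr (_ + _); first by rewrite big_imset //= => u v _ _ /set1_inj.
rewrite big_imset /=; last first.
  move=> k l _ _ e; apply: val_inj => /=.
  by rewrite -(@card_prefix_set phi k) -1?ltnS // e card_prefix_set -1?ltnS.
by rewrite big_geq_mkord; apply: eq_bigl => k; rewrite inE.
Qed.

Lemma linear_tree_index (s : seq T) : enumeration s ->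
  linear_tree s = tree_of (fun v => (index v s).+1).
Proof.
move=> [us sT]; congr (_ :|: _).
  by apply/setP => X; apply/imsetP/imsetP => -[v _ ->]; exists v.
by apply: eq_imset => k; apply/setP => v; rewrite !inE in_take.
Qed.

(** Reassemblings can thus be handled through arrangements. For the converse direction, the
    enumeration is [enum T] sorted by [phi]. *)
Lemma linear_binary_treeP L : linear_binary_tree L <->
  exists2 phi, linear_arrangement phi & L = tree_of phi.
Proof.
split=> [[s es ->]|[phi phiA ->]].
  exists (fun v => (index v s).+1); last exact: linear_tree_index.
  have [us sT] := es; apply: inj_linear_arrangement => [u v [e]|v].
    exact: (@index_inj _ u s _ _ (sT u) (sT v) e).
  have -> : #|T| = size s.
    by rewrite -(card_uniqP us); apply: eq_card => x; rewrite inE sT.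
  by rewrite index_mem sT.
have [phiI phiB _] := phiA.
pose s := sort (relpre phi leq) (enum T).
have ps : map phi s = iota 1 #|T|.
  apply: (sorted_eq leq_trans anti_leq).
  - by rewrite sorted_map; apply: sort_sorted => u v; apply: leq_total.
  - exact: iota_sorted.
  - apply: perm_trans (linear_arrangement_perm phiA).
    by rewrite perm_map // perm_sort.
have es : enumeration s.
  by split=> [|v]; rewrite ?sort_uniq ?enum_uniq ?mem_sort ?mem_enum.
exists s => //; rewrite linear_tree_index //; congr (_ :|: _).
apply: eq_imset => k; apply/setP => v; rewrite !inE.
rewrite -(index_map phiI) ps.
suff -> : (index (phi v) (iota 1 #|T|)).+1 = phi v by [].
have := phiB v; case: (phi v) => // i iT.
have {1}-> : i.+1 = nth 0 (iota 1 #|T|) i by rewrite nth_iota.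
by rewrite index_uniq ?size_iota ?iota_uniq.
Qed.

End Arrangements.

(** * Degrees and costs as sums over ordered pairs of vertices *)

Section Costs.
Variables (V : finType) (G : sgraph V).
Implicit Types (X : {set V}) (phi : V -> nat).

Definition adj u v : bool := [set u; v] \in edges G.

Lemma adjC u v : adj u v = adj v u.
Proof. by rewrite /adj setUC. Qed.

Lemma adjnn u : adj u u = false.
Proof.
apply/negP => /(forall_inP (edgesP G)).
by rewrite setUid cards1.
Qed.

(** A cut edge has exactly one orientation that leaves [X], so [h] maps the ordered pairs leaving
    [X] bijectively onto the cut edges. *)
Lemma degE X :
  deg G X = \sum_u \sum_v (adj u v && (u \in X) && (v \notin X)).
Proof.
pose P := [set p : V * V | [&& adj p.1 p.2, p.1 \in X & p.2 \notin X]].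
pose h (p : V * V) := [set p.1; p.2].
have -> : \sum_u \sum_v (adj u v && (u \in X) && (v \notin X)) = #|P|.
  rewrite pair_big -sum1_card [RHS]big_mkcond /=.
  by apply: eq_bigr => -[u v] _; rewrite inE /= -andbA; case: (_ && _).
have capE (u v : V) : u \in X -> v \notin X -> [set u; v] :&: X = [set u].
  move=> uX vX; apply/setP => x; rewrite !inE.
  have [->|_] /= := eqVneq x u; first by rewrite uX.
  by have [->|_] := eqVneq x v; rewrite ?(negbTE vX).
rewrite -(card_in_imset (f := h)) => [|[u v] [u' v']]; last first.
  rewrite !inE /h /= => /and3P[_ uX vX] /and3P[_ u'X v'X] e.
  have eu : u = u'.
    by apply: set1_inj; rewrite -(capE u v) // e capE.
  have : v \in [set u'; v'] by rewrite -e !inE eqxx orbT.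
  rewrite !inE => /orP[/eqP ev|/eqP ->]; last by rewrite eu.
  by rewrite ev u'X in vX.
apply: eq_card => e; apply/idP/imsetP; rewrite !inE.
  move=> /andP[eE e1]; have /cards2P[u [v [nuv ee]]] := forall_inP (edgesP G) _ eE.
  have := e1; rewrite ee.
  have [uX|uX] := boolP (u \in X); have [vX|vX] := boolP (v \in X).
  - by rewrite (setIidPl _) ?cards2 ?nuv // subUset !sub1set uX.
  - by exists (u, v); rewrite // inE uX vX /adj -ee eE.
  - by exists (v, u); rewrite ?inE ?uX ?vX /adj /h /= ?(setUC [set v]) -?ee ?eE.
  - suff -> : [set u; v] :&: X = set0 by rewrite cards0.
    apply/setP => x; rewrite !inE; have [->|_] := eqVneq x u; first exact: negbTE.
    by have [->|_] := eqVneq x v; rewrite ?(negbTE vX).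
case=> -[u v]; rewrite inE /h /= => /and3P[uv uX vX] ->.
by rewrite capE // cards1 andbT.
Qed.

Lemma deg1E v : deg G [set v] = \sum_u adj v u.
Proof.
rewrite degE (bigD1 v) //= [X in _ + X]big1 ?addn0 => [|u uv]; last first.
  by apply: big1 => x _; rewrite inE (negbTE uv) andbF.
apply: eq_bigr => u _; rewrite !inE eqxx andbT.
by have [->|] := eqVneq u v; rewrite ?andbT // adjnn.
Qed.

Definition edge_cost phi := stretch (fun u v => adj u v) phi.

(** The edge from [u] to [v] with [phi u < phi v] is cut by the prefixes at levels
    [phi u <= i < phi v]; exchanging the sums gives its length. *)
Lemma beta_arrangementE phi : linear_arrangement phi ->
  beta_arrangement G phi = edge_cost phi.
Proof.
move=> [_ phiB _]; rewrite /beta_arrangement /edge_cost /stretch.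
under eq_bigr => i _ do rewrite degE.
rewrite exchange_big; apply: eq_bigr => u _ /=.
rewrite exchange_big; apply: eq_bigr => v _ /=.
have [/andP[u0 _] /andP[_ vV]] := (phiB u, phiB v).
rewrite -(@sum_leq_between #|V| (phi u) (phi v)) // 1?leqW // big_distrr /=.
by apply: eq_bigr => i _; rewrite !inE -ltnNge -andbA mulnb.
Qed.

(** The part of the reassembling cost that depends on the arrangement: the singletons contribute the
    same to every reassembling. *)
Definition gap_cost phi := \sum_(2 <= k < #|V|.+1) deg G (prefix_set phi k).

Lemma beta_reassemblingE phi : linear_arrangement phi ->
  beta_reassembling G (tree_of phi) = \sum_v deg G [set v] + gap_cost phi.
Proof. exact: sum_tree_of. Qed.

Lemma edge_cost_rank (f : V -> nat) : injective f ->
  edge_cost (rank f) <= edge_cost f.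
Proof. exact: stretch_rank. Qed.

(** The prefix at level 1 is [[set a]]; its degree is the reward that separates the two problems. *)
Lemma edge_cost_gap phi a : linear_arrangement phi -> phi a = 1 ->
  edge_cost phi = deg G [set a] + gap_cost phi.
Proof.
move=> phiA phia; have [phiI phiB _] := phiA.
rewrite -beta_arrangementE // /beta_arrangement big_ltn; last first.
  by have := phiB a; lia.
congr (deg G _ + _); apply/setP => v; rewrite !inE.
by have := phiB v; rewrite -(inj_eq phiI) phia; lia.
Qed.

End Costs.

(** * Disjoint union with a clique *)

Definition absd x y := (x - y) + (y - x).

Lemma optimal_arrangementP (V : finType) (G : sgraph V) phi psi :
  optimal_arrangement G phi -> linear_arrangement psi ->
  edge_cost G phi <= edge_cost G psi.
Proof.
by case=> phiA phiO psiA; rewrite -!beta_arrangementE //; apply: phiO.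
Qed.

Lemma eq_stretch (T : finType) (w w' : T -> T -> nat) f f' :
  w =2 w' -> f =1 f' -> stretch w f = stretch w' f'.
Proof.
by move=> ew ef; apply: eq_bigr => u _; apply: eq_bigr => v _; rewrite ew !ef.
Qed.

Lemma leq_inj_between k (f : 'I_k -> nat) p q :
  injective f -> (forall i, p < f i < q) -> k <= q - p.
Proof.
move=> fI fB; rewrite -[X in X <= _]card_ord cardE -(size_map f).
rewrite -[X in _ <= X](size_iota p.+1); apply: uniq_leq_size.
  by rewrite map_inj_uniq ?enum_uniq.
by move=> _ /mapP[i _ ->]; rewrite mem_iota; have := fB i; nlia.
Qed.

(** * Functions and stretches on a sum of two ordinals *)

Section Glue.
Variables n m : nat.

Definition glue (g : 'I_n -> nat) (h : 'I_m -> nat) (x : 'I_(n + m)) :=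
  match split x with inl v => g v | inr k => h k end.

Lemma glueL g h v : glue g h (lshift m v) = g v.
Proof. by rewrite /glue (unsplitK (inl v)). Qed.

Lemma glueR g h k : glue g h (rshift n k) = h k.
Proof. by rewrite /glue (unsplitK (inr k)). Qed.

Lemma glue_inj g h : injective g -> injective h ->
  (forall v k, g v != h k) -> injective (glue g h).
Proof.
move=> gI hI gh x y; case: (split_ordP x) => i ->; case: (split_ordP y) => j ->;
  rewrite ?glueL ?glueR.
- by move/gI->.
- by move=> e; have := gh i j; rewrite e eqxx.
- by move=> e; have := gh j i; rewrite e eqxx.
- by move/hI->.
Qed.

Lemma glue_linear_arrangement g h : injective g -> injective h ->
  (forall v k, g v != h k) -> (forall v, 1 <= g v <= n + m) ->
  (forall k, 1 <= h k <= n + m) -> linear_arrangement (glue g h).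
Proof.
move=> gI hI gh gB hB; apply: inj_linear_arrangement; first exact: glue_inj.
move=> x; rewrite card_ord.
by case: (split_ordP x) => i ->; rewrite ?glueL ?glueR.
Qed.

(** Pairs are sorted into left, right and mixed ones. By symmetry of [w] the two orders of a mixed
    pair combine into an absolute distance. *)
Lemma stretch_split (w : 'I_(n + m) -> 'I_(n + m) -> nat) f :
  (forall x y, w x y = w y x) ->
  stretch w f =
    stretch (fun u v => w (lshift m u) (lshift m v)) (f \o @lshift n m) +
    stretch (fun k l => w (rshift n k) (rshift n l)) (f \o @rshift n m) +
    \sum_u \sum_k w (lshift m u) (rshift n k) *
                  absd (f (lshift m u)) (f (rshift n k)).
Proof.
move=> wC; rewrite /stretch big_split_ord /=.
under eq_bigr => u _ do rewrite big_split_ord /=.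
under [X in _ + X]eq_bigr => u _ do rewrite big_split_ord /=.
rewrite !big_split /= [X in _ + (X + _) = _]exchange_big /=.
rewrite -!addnA; congr (_ + _).
rewrite addnA addnC; congr (_ + _).
rewrite -big_split; apply: eq_bigr => u _ /=.
rewrite -big_split; apply: eq_bigr => k _ /=.
by rewrite (wC (rshift n k)) -mulnDr /absd addnC.
Qed.

End Glue.

Lemma sum_ord_neq m (k : 'I_m) : \sum_(l < m) (k != l) = m.-1.
Proof.
rewrite (bigD1 k) //= eqxx add0n -[in RHS](card_ord m) (cardD1 k) inE /=.
rewrite -sum1_card; apply: eq_big => [l|l]; first by rewrite !inE andbT.
by rewrite eq_sym => ->.
Qed.

Section DisjointClique.
Variables (n m : nat) (G : sgraph 'I_n) (H : sgraph 'I_(n + m)).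
Hypothesis lt_nm : n < m.
Hypothesis adjHll : forall u v, adj H (lshift m u) (lshift m v) = adj G u v.
Hypothesis adjHlr : forall u k, adj H (lshift m u) (rshift n k) = false.
Hypothesis adjHrr : forall k l, adj H (rshift n k) (rshift n l) = (k != l).

Lemma stretch_disjoint_clique f :
  edge_cost H f = edge_cost G (f \o @lshift n m) +
    stretch (fun k l : 'I_m => k != l) (f \o @rshift n m).
Proof.
rewrite /edge_cost stretch_split => [|x y]; last by rewrite adjC.
rewrite [X in _ + X]big1 ?addn0 => [|u _]; last first.
  by apply: big1 => k _; rewrite adjHlr.
by congr (_ + _); apply: eq_stretch => // u v; rewrite ?adjHll ?adjHrr.
Qed.

Lemma deg_clique_vertex k : deg H [set rshift n k] = m.-1.
Proof.
rewrite deg1E big_split_ord /= big1 ?add0n => [|u _].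
  by under eq_bigr => l _ do rewrite adjHrr; rewrite sum_ord_neq.
by rewrite adjC adjHlr.
Qed.

(** Since [n < m], this is strictly below the degree [m.-1] of a clique vertex, so starting in [G]
    earns a strictly smaller reward. *)
Lemma deg_graph_vertex v : deg H [set lshift m v] < n.
Proof.
rewrite deg1E big_split_ord /= [X in _ + X]big1 ?addn0 => [|u _].
  have n0 : 0 < n by case: v => ? ?; nlia.
  rewrite -[X in _ < X](prednK n0) ltnS -[X in _ <= X](sum_ord_neq v).
  apply: leq_sum => u _.
  by rewrite adjHll; have [<-|_] := eqVneq; rewrite ?adjnn // leq_b1.
by rewrite adjHlr.
Qed.

Variable phi : 'I_(n + m) -> nat.
Hypothesis phiA : linear_arrangement phi.
Hypothesis phiO : optimal_reassembling H (tree_of phi).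

Let phil := phi \o @lshift n m.
Let phir := phi \o @rshift n m.

Let phi_inj : injective phi. Proof. by case: phiA. Qed.

Let phil_inj : injective phil.
Proof. exact: inj_comp phi_inj (@lshift_inj _ _). Qed.

Let phir_inj : injective phir.
Proof. exact: inj_comp phi_inj (@rshift_inj _ _). Qed.

(* Moving the clique in front of G gives the largest possible saving on the
   first vertex, and cannot lengthen the edges of the clique. *)
Lemma optimal_reassembling_exchange chi x : linear_arrangement chi -> phi x = 1 ->
  edge_cost G phil + m.-1 <= edge_cost G chi + deg H [set x].
Proof.
move=> chiA phix; have [chiI chiB _] := chiA.
have [rhoI rhoB rhoS] := rank_linear_arrangement phir_inj.
rewrite card_ord in chiB; rewrite card_ord in rhoB.
pose f := glue (fun v => m + chi v) (rank phir).
have fA : linear_arrangement f.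
  apply: glue_linear_arrangement => // [u v /addnI/chiI //|v k|v|k].
  - by have := chiB v; have := rhoB k; nlia.
  - by have := chiB v; nlia.
  - by have := rhoB k; nlia.
have [k fk] : exists k, f (rshift n k) = 1.
  have [|k] := rhoS 1; first by rewrite card_ord; nlia.
  by exists k; rewrite /f glueR.
have : beta_reassembling H (tree_of phi) <= beta_reassembling H (tree_of f).
  by apply: phiO.2; apply/linear_binary_treeP; exists f.
rewrite !beta_reassemblingE // leq_add2l => le_gap.
have /= := edge_cost_gap H phiA phix; have := edge_cost_gap H fA fk.
rewrite deg_clique_vertex !stretch_disjoint_clique -/phil -/phir.
have -> : edge_cost G (f \o @lshift n m) = edge_cost G chi.
  apply: eq_bigr => u _; apply: eq_bigr => v _.
  by rewrite /= /f !glueL subnDl.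
have -> : stretch (fun k l : 'I_m => k != l) (f \o @rshift n m) =
          stretch (fun k l : 'I_m => k != l) (rank phir).
  by apply: eq_stretch => // l; rewrite /= /f glueR.
have := stretch_rank (fun k l : 'I_m => k != l) phir_inj. nlia.
Qed.

(** Otherwise [v] comes first, and the exchange with the order induced on [G] itself gives [m.-1 <=
    deg H [set v]], against the degree bound. *)
Lemma first_in_clique v : 1 < phil v.
Proof.
have [_ /(_ (lshift m v)) phiB _] := phiA.
rewrite ltn_neqAle eq_sym andbC (proj1 (andP phiB)) /=.
apply/eqP => phiv; have := edge_cost_rank G (f := phil) phil_inj.
have := optimal_reassembling_exchange (rank_linear_arrangement phil_inj) phiv.
by have := deg_graph_vertex v; nlia.
Qed.

(** As the first vertex lies in the clique, its reward [m.-1] cancels in the exchange inequality,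
    and compressing to ranks does not raise the cost. *)
Lemma restricted_rank_optimal : optimal_arrangement G (rank phil).
Proof.
have rA := rank_linear_arrangement phil_inj; split=> // chi chiA.
rewrite !beta_arrangementE //.
have [|x phix] := linear_arrangement_first phiA; first by rewrite card_ord; nlia.
have := optimal_reassembling_exchange chiA phix.
have := edge_cost_rank G (f := phil) phil_inj.
case: (split_ordP x) => i ei; rewrite ei.
  by have := first_in_clique i; rewrite /phil /= -ei phix.
by rewrite deg_clique_vertex; nlia.
Qed.

(** A vertex lies in its own singleton and in the prefixes from its position up to [n + m]. The
    count decreases with the position, so it reveals the order however the members are listed. *)
Lemma membership_count v :
  \sum_(X in tree_of phi) (lshift m v \in X) = (n + m).+2 - phil v.
Proof.
have vB : 1 < phil v <= n + m.
  rewrite first_in_clique; case: phiA => _ /(_ (lshift m v)).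
  by rewrite card_ord => /andP[].
rewrite (sum_tree_of (fun X => (lshift m v \in X) : nat)) //.
rewrite (bigD1 (lshift m v)) //=.
rewrite set11 big1 => [|u]; last by rewrite inE eq_sym => /negbTE->.
(* The level sum starts at 1 but the prefixes at 2; the dropped term vanishes because
   [1 < phil v]. *)
have := @sum_leq_between (n + m) (phil v) (n + m).+1.
rewrite card_ord big_ltn //=; last by nlia.
have -> : phil v <= 1 < (n + m).+1 = false by nlia.
rewrite add0n => e.
rewrite (eq_big_nat _ _ (F2 := fun i => phil v <= i < (n + m).+1 : nat)).
  by rewrite e; nlia.
by move=> i /andP[_ ->]; rewrite inE andbT.
Qed.

End DisjointClique.

(** * A clique pendant at a vertex *)

(** The cost of a complete graph on [k] vertices, which is the same for all its linear
    arrangements. *)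
Definition complete_cost k := \sum_(1 <= i < k.+1) \sum_(1 <= j < k.+1) (j - i).

Lemma stretch_complete (T : finType) (f : T -> nat) : linear_arrangement f ->
  stretch (fun _ _ => 1) f = complete_cost #|T|.
Proof.
move=> fA; rewrite /stretch /complete_cost -(sum_linear_arrangement _ fA).
apply: eq_bigr => u _; rewrite -(sum_linear_arrangement (fun j => j - f u) fA).
by apply: eq_bigr => v _; rewrite mul1n.
Qed.

Lemma leq_complete_stretch (T : finType) (f : T -> nat) : injective f ->
  complete_cost #|T| <= stretch (fun _ _ => 1) f.
Proof.
move=> fI; rewrite -(stretch_complete (rank_linear_arrangement fI)).
exact: stretch_rank.
Qed.

(** With [p] points below the hole [c] and [q] above, each of the [p * q] pairs across it is longer
    by at least one than in the compressed order, and [p * q >= p + q - 1] for positive [p] and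
    [q]. *)
Lemma complete_stretch_gap (T : finType) (f : T -> nat) c u v :
  injective f -> (forall x, f x != c) -> f u < c < f v ->
  complete_cost #|T| + #|T|.-1 <= stretch (fun _ _ => 1) f.
Proof.
move=> fI fc ucv.
rewrite -(stretch_complete (rank_linear_arrangement fI)).
have cf : c \notin codom f.
  by apply/negP => /codomP[x e]; have := fc x; rewrite -e eqxx.
pose p := \sum_x (f x < c); pose q := \sum_x (c < f x).
have pq : p + q = #|T|.
  rewrite -sum1_card -big_split; apply: eq_bigr => x _ /=.
  by have := fc x; lia.
have p0 : 0 < p by rewrite /p (bigD1 u) //=; lia.
have q0 : 0 < q by rewrite /q (bigD1 v) //=; lia.
apply: leq_trans (_ : stretch (fun _ _ => 1) (rank f) + p * q <= _).
  by rewrite leq_add2l -pq; nia.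
rewrite /p big_distrl -big_split; apply: leq_sum => x _ /=.
rewrite /q big_distrr -big_split; apply: leq_sum => y _ /=.
by rewrite !mul1n mulnb; have := rank_dist_gap c x y fI; rewrite cf andbT.
Qed.

Section PendantClique.
Variables (n m : nat) (G : sgraph 'I_n) (H : sgraph 'I_(n + m)) (a : 'I_n).
Hypothesis m_big : n * (n * n) + n * n < m.
Hypothesis adjHll : forall u v, adj H (lshift m u) (lshift m v) = adj G u v.
Hypothesis adjHlr : forall u k,
  adj H (lshift m u) (rshift n k) = (u == a) || (val k == 0).
Hypothesis adjHrr : forall k l, adj H (rshift n k) (rshift n l) = (k != l).

Let m_gt0 : 0 < m. Proof. by apply: leq_trans m_big. Qed.

Let hub : 'I_(n + m) := rshift n (Ordinal m_gt0).

(** The clique together with [a] spans a complete graph on [m.+1] vertices; index 0 stands for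
    [a]. *)
Definition block (i : 'I_m.+1) : 'I_(n + m) :=
  if unlift ord0 i is Some k then rshift n k else lshift m a.

Lemma block0 : block ord0 = lshift m a.
Proof. by rewrite /block unlift_none. Qed.

Lemma blockS k : block (lift ord0 k) = rshift n k.
Proof. by rewrite /block liftK. Qed.

Lemma block_inj : injective block.
Proof.
move=> i j; rewrite /block.
case: unliftP => [k ->|->]; case: unliftP => [l ->|->] //.
- by move/rshift_inj->.
- by move/eqP; rewrite eq_rlshift.
- by move/eqP; rewrite eq_lrshift.
Qed.

Lemma blockP x : (exists i, x = block i) \/ exists2 v, v != a & x = lshift m v.
Proof.
case: (split_ordP x) => [v ->|k ->]; last by left; exists (lift ord0 k); rewrite blockS.
have [->|va] := eqVneq v a; last by right; exists v.
by left; exists ord0; rewrite block0.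
Qed.

Lemma block_neq v i : v != a -> lshift m v != block i.
Proof.
rewrite /block; case: unliftP => [k _|_ va]; first by rewrite eq_lrshift.
by rewrite (inj_eq (@lshift_inj _ _)).
Qed.

(** The edge from [a] to the hub is left out because it belongs to the complete graph on the
    block. *)
Definition hub_cost (f : 'I_(n + m) -> nat) :=
  \sum_(v | v != a) absd (f (lshift m v)) (f hub).

(** The edges fall into three classes: those of [G], those inside the block, and those from the hub
    to the vertices of [G] other than [a]. *)
Lemma edge_cost_pendant_clique f :
  edge_cost H f = edge_cost G (f \o @lshift n m) +
    stretch (fun _ _ => 1) (f \o block) + hub_cost f.
Proof.
rewrite {1}/edge_cost stretch_split => [|x y]; last by rewrite adjC.
rewrite -!addnA; congr (_ + _).
  by apply: eq_stretch => // u v; rewrite adjHll.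
have -> : stretch (fun _ _ => 1) (f \o block) =
    stretch (fun k l => adj H (rshift n k) (rshift n l)) (f \o @rshift n m) +
    \sum_k absd (f (lshift m a)) (f (rshift n k)).
  rewrite {1}/stretch big_ord_recl big_ord_recl /= subnn add0n.
  under [X in _ + X = _]eq_bigr => i _ do rewrite big_ord_recl.
  rewrite [X in _ + X = _]big_split /= addnA addnC -big_split; congr (_ + _); last first.
    by apply: eq_bigr => k _; rewrite /= block0 blockS !mul1n /absd addnC.
  apply: eq_bigr => k _; apply: eq_bigr => l _.
  by rewrite /= !blockS adjHrr; have [->|_] := eqVneq; rewrite ?subnn.
rewrite -addnA; congr (_ + _); rewrite (bigD1 a) //=; congr (_ + _).
  by apply: eq_bigr => k _; rewrite adjHlr eqxx mul1n.
apply: eq_bigr => v va; rewrite (bigD1 (Ordinal m_gt0)) //= adjHlr orbT mul1n.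
rewrite big1 ?addn0 // => k kh; rewrite adjHlr (negbTE va) /=.
by have -> : (val k == 0) = false by apply: contraNF kh => /eqP e; apply/eqP/val_inj.
Qed.

Lemma exists_first : exists2 chi : 'I_n -> nat, linear_arrangement chi & chi a = 1.
Proof.
pose d (v : 'I_n) := if v == a then 0 else v.+1.
have dI : injective d.
  move=> u v; rewrite /d; have [->|_] := eqVneq u a; have [->|_] := eqVneq v a => //.
  by move=> [] /val_inj.
exists (rank d); first exact: rank_linear_arrangement.
rewrite rankE (bigD1 a) //= leqnn big1 // => u ua.
by rewrite /d eqxx (negbTE ua).
Qed.

(* The clique in decreasing order ends at the hub; then comes [a] and then the
   rest of G. *)
Lemma cheap_arrangement : exists2 f, linear_arrangement f &
  edge_cost H f < complete_cost m.+1 + m.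
Proof.
have [chi chiA chia] := exists_first; have [chiI chiB _] := chiA.
rewrite card_ord in chiB.
pose f := glue (fun v => m + chi v) (fun k : 'I_m => m - k).
have fA : linear_arrangement f.
  apply: glue_linear_arrangement => [u v /addnI/chiI //|k l e|v k|v|k].
  - by apply: val_inj => /=; have := ltn_ord k; have := ltn_ord l; lia.
  - by have := chiB v; lia.
  - by have := chiB v; lia.
  - by have := ltn_ord k; lia.
exists f => //; rewrite edge_cost_pendant_clique stretch_complete; last first.
  apply: inj_linear_arrangement => [|i].
    by apply: inj_comp block_inj; case: fA.
  rewrite card_ord /= /block; case: unliftP => [k _|_]; rewrite /f ?glueL ?glueR.
    by rewrite subn_gt0 ltn_ord leqW ?leq_subr.
  by rewrite chia; lia.
(* The two bounds [n * (n * n)] and [n * n] are the summands of [m_big]. *)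
rewrite card_ord; have c1 : edge_cost G (f \o @lshift n m) <= n * (n * n).
  apply: leq_trans (_ : \sum_(u < n) \sum_(v < n) n <= _).
    apply: leq_sum => u _; apply: leq_sum => v _.
    rewrite /= /f !glueL; have := chiB v; case: adj => /=; lia.
  by rewrite !sum_nat_const card_ord.
have c2 : hub_cost f <= n * n.
  apply: leq_trans (_ : \sum_(v < n) n <= _).
    rewrite /hub_cost big_mkcond; apply: leq_sum => v _.
    rewrite /= /f /hub glueL glueR /absd /=; have := chiB v; case: ifP; lia.
  by rewrite sum_nat_const card_ord.
by nlia.
Qed.

(** * Shape of the optimal arrangements of the auxiliary graph *)

Section Optimal.
Variable phi : 'I_(n + m) -> nat.
Hypothesis phiO : optimal_arrangement H phi.

Let phiA : linear_arrangement phi. Proof. by case: phiO. Qed.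
Let phi_inj : injective phi. Proof. by case: phiA. Qed.
Let phib_inj : injective (phi \o block). Proof. exact: inj_comp block_inj. Qed.
Let phil_inj : injective (phi \o @lshift n m).
Proof. exact: inj_comp (@lshift_inj _ _). Qed.

Let phi_cheap : edge_cost H phi < complete_cost m.+1 + m.
Proof.
have [f fA] := cheap_arrangement; apply: leq_ltn_trans.
exact: optimal_arrangementP.
Qed.

(** A vertex inside the span of the block leaves a hole there, which adds at least [m] to
    [complete_cost m.+1] and contradicts [phi_cheap]. *)
Lemma vertex_beside_block v i j : v != a ->
  ~~ (phi (block i) < phi (lshift m v) < phi (block j)).
Proof.
move=> va; apply/negP => vij; have := phi_cheap.
rewrite edge_cost_pendant_clique.
have := @complete_stretch_gap _ (phi \o block) (phi (lshift m v)) i j phib_inj.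
rewrite card_ord /= => gap.
suff : complete_cost m.+1 + m <= stretch (fun _ _ => 1) (phi \o block) by nlia.
by apply: gap => // x; rewrite inj_eq // eq_sym block_neq.
Qed.

(** The whole block would lie between [u] and [v]. Their two hub edges together cover this distance
    of at least [m.+1], which again exceeds [phi_cheap]. *)
Lemma vertices_same_side u v : u != a -> v != a ->
  phi (lshift m u) < phi (lshift m a) < phi (lshift m v) -> False.
Proof.
move=> ua va uav.
have B i : phi (lshift m u) < phi (block i) < phi (lshift m v).
  have := vertex_beside_block i ord0 ua; have := vertex_beside_block ord0 i va.
  rewrite block0.
  have := block_neq i ua; have := block_neq i va.
  by rewrite -!(inj_eq phi_inj); lia.
have := leq_inj_between phib_inj B; have := phi_cheap.
rewrite edge_cost_pendant_clique.
have := leq_complete_stretch phib_inj; rewrite card_ord.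
suff : phi (lshift m v) - phi (lshift m u) <= hub_cost phi by nlia.
have vu : v != u by apply: contraTneq uav => ->; lia.
rewrite /hub_cost (bigD1 v) // (bigD1 u) /=; last by rewrite ua eq_sym.
by rewrite /absd; lia.
Qed.

Section RightSide.
Hypothesis phi_right : forall v, v != a -> phi (lshift m a) < phi (lshift m v).

Let psi := rank (phi \o @lshift n m).

Lemma block_below v i : v != a -> phi (block i) < phi (lshift m v).
Proof.
move=> va; have := vertex_beside_block ord0 i va; have := phi_right va.
by have := block_neq i va; rewrite block0 -(inj_eq phi_inj); lia.
Qed.

Lemma block_bound i : phi (block i) <= m.+1.
Proof.
rewrite -(rank_id (block i) phiA) rankE big_split_ord /= (bigD1 a) //=.
rewrite [X in _ + X + _]big1 => [|v va]; last first.
  by have := block_below i va; lia.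
rewrite addn0; apply: leq_trans (_ : 1 + \sum_(k < m) 1 <= _).
  by apply: leq_add; [exact: leq_b1 | apply: leq_sum => k _; exact: leq_b1].
by rewrite sum_nat_const card_ord muln1.
Qed.

(** All [m] clique vertices precede [v], and the other vertices up to [v] are those counted by
    [psi]. *)
Lemma phi_shift v : v != a -> phi (lshift m v) = m + psi v.
Proof.
move=> va; rewrite -(rank_id (lshift m v) phiA) rankE big_split_ord /= addnC.
congr (_ + _); last by rewrite /psi rankE.
rewrite -[RHS]muln1 -[X in _ = X * _](card_ord m) -sum_nat_const.
by apply: eq_bigr => k _; rewrite -blockS ltnW // block_below.
Qed.

Lemma psi_first : psi a = 1.
Proof.
rewrite /psi rankE (bigD1 a) //= leqnn big1 // => v va.
by have := phi_right va; lia.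
Qed.

(** Everything on the right except [edge_cost G chi] is independent of [chi]. The vertex [a] sits at
    [phi (lshift m a)] rather than at [m.+1], which lengthens each of its edges in [G] by the same
    amount. The hub edges end at the positions [m + i] with [2 <= i]; the term for [i = 1] is added
    on both sides. *)
Lemma edge_cost_shift f chi : linear_arrangement chi -> chi a = 1 ->
  (forall i, f (block i) = phi (block i)) ->
  (forall v, v != a -> f (lshift m v) = m + chi v) ->
  edge_cost H f + absd m.+1 (phi hub) = edge_cost G chi +
    ((m.+1 - phi (lshift m a)) * deg G [set a] +
     stretch (fun _ _ => 1) (phi \o block) +
     \sum_(1 <= i < n.+1) absd (m + i) (phi hub)).
Proof.
move=> chiA chia fb fl; have [chiI chiB _] := chiA.
rewrite card_ord in chiB.
have := sum_linear_arrangement (fun i => absd (m + i) (phi hub)) chiA.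
rewrite card_ord => <-; rewrite edge_cost_pendant_clique.
have -> : stretch (fun _ _ => 1) (f \o block) = stretch (fun _ _ => 1) (phi \o block).
  by apply: eq_stretch => // i; rewrite /= fb.
have -> : \sum_v absd (m + chi v) (phi hub) = hub_cost f + absd m.+1 (phi hub).
  rewrite (bigD1 a) //= chia addn1 addnC; congr (_ + _).
  by apply: eq_bigr => v va; rewrite fl // /hub -!blockS fb.
suff -> : edge_cost G (f \o @lshift n m) =
    edge_cost G chi + (m.+1 - phi (lshift m a)) * deg G [set a] by nlia.
rewrite deg1E /edge_cost /stretch (bigD1 a) //= [in RHS](bigD1 a) //=.
rewrite addnAC big_distrr -big_split; congr (_ + _).
  apply: eq_bigr => v _ /=; have [->|va] := eqVneq v a; first by rewrite adjnn muln0.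
  rewrite fl // -block0 fb chia.
  have := block_bound ord0; have := chiB v.
  by case: adj; rewrite ?mul0n ?muln0 // !mul1n muln1; lia.
apply: eq_bigr => u ua; apply: eq_bigr => v _ /=; congr (_ * _).
have [->|va] := eqVneq v a; last by rewrite !fl // subnDl.
rewrite (fl u) // -block0 fb; have := block_bound ord0; have := chiB u.
have : chi u != chi a by rewrite (inj_eq chiI).
by lia.
Qed.

(** Keeping the block in place and reordering the rest of [G] by [chi] yields a competitor [f] of
    [phi]; by [edge_cost_shift] the comparison in [H] reduces to one in [G]. *)
Lemma psi_optimal_first chi : linear_arrangement chi -> chi a = 1 ->
  edge_cost G psi <= edge_cost G chi.
Proof.
move=> chiA chia; have [chiI chiB _] := chiA; rewrite card_ord in chiB.
have psiA : linear_arrangement psi by apply: rank_linear_arrangement.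
pose f := glue (fun v => if v == a then phi (lshift m a) else m + chi v)
               (phi \o @rshift n m).
have fb i : f (block i) = phi (block i).
  by rewrite /block /f; case: unliftP => [k _|_]; rewrite ?glueL ?glueR ?eqxx.
have fl v : v != a -> f (lshift m v) = m + chi v.
  by rewrite /f glueL => /negbTE->.
have chi2 v : v != a -> 1 < chi v.
  by rewrite -(inj_eq chiI) chia; have := chiB v; lia.
have [_ phiB _] := phiA.
have fA : linear_arrangement f.
  apply: inj_linear_arrangement => [x y|x]; last first.
    case: (blockP x) => [[i ->]|[v va ->]]; rewrite ?fb // fl // card_ord.
    by have := chiB v; lia.
  case: (blockP x) => [[i ->]|[u ua ->]]; case: (blockP y) => [[j ->]|[v va ->]];
    rewrite ?fb ?fl //.
  - by move/phi_inj.
  - by have := block_bound i; have := chi2 _ va; lia.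
  - by have := block_bound j; have := chi2 _ ua; lia.
  - by move/addnI/chiI->.
have le := optimal_arrangementP phiO fA.
have := edge_cost_shift chiA chia fb fl.
have := edge_cost_shift psiA psi_first (fun=> erefl) phi_shift.
by nlia.
Qed.

End RightSide.
End Optimal.

(** Reversal swaps the two truncated differences of each pair, so by symmetry of adjacency the cost
    is unchanged. *)
Lemma reflect_optimal phi : optimal_arrangement H phi ->
  optimal_arrangement H (fun x => (n + m).+1 - phi x).
Proof.
case=> phiA phiO; have [phiI phiB _] := phiA; rewrite card_ord in phiB.
have rA : linear_arrangement (fun x => (n + m).+1 - phi x).
  apply: inj_linear_arrangement => [x y e|x]; last by rewrite card_ord; have := phiB x; lia.
  by apply: phiI; have := phiB x; have := phiB y; lia.
split=> // chi chiA; apply: leq_trans (phiO _ chiA).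
rewrite !beta_arrangementE // /edge_cost /stretch exchange_big /=.
apply: leq_sum => u _; apply: leq_sum => v _; rewrite adjC leq_mul2l.
by have := phiB u; have := phiB v; lia.
Qed.

(** Distances to [a] are invariant under reflection, so [G] may be assumed to lie to the right of
    [a], where they induce the order of [phi]. A program using them need not know the side. *)
Lemma distance_rank_optimal phi :
  let d := fun v => absd (phi (lshift m v)) (phi (lshift m a)) in
  optimal_arrangement H phi ->
  [/\ injective d, rank d a = 1 &
      forall chi, linear_arrangement chi -> chi a = 1 ->
        edge_cost G (rank d) <= edge_cost G chi].
Proof.
move=> d phiO.
have right psi : optimal_arrangement H psi ->
    (forall v, v != a -> psi (lshift m a) < psi (lshift m v)) ->
    (forall v, d v = absd (psi (lshift m v)) (psi (lshift m a))) ->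
    [/\ injective d, rank d a = 1 &
      forall chi, linear_arrangement chi -> chi a = 1 ->
        edge_cost G (rank d) <= edge_cost G chi].
  move=> psiO psiR dE; have [[psiI _ _] _] := psiO.
  have ge v : psi (lshift m a) <= psi (lshift m v).
    by have [->//|/psiR/ltnW] := eqVneq v a.
  have dr : rank d =1 rank (psi \o @lshift n m).
    apply: eq_rank => u v; rewrite !dE /absd /=.
    by have := ge u; have := ge v; lia.
  split=> [u v||chi chiA chia].
  - rewrite !dE /absd => e; apply/(@lshift_inj n m)/psiI.
    by have := ge u; have := ge v; lia.
  - by rewrite dr psi_first.
  - have -> : edge_cost G (rank d) = edge_cost G (rank (psi \o @lshift n m)).
      exact: eq_stretch.
    exact: psi_optimal_first.
have [[phiI phiB _] _] := phiO; rewrite card_ord in phiB.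
have [/forallP R|/forallPn[u]] :=
  boolP [forall v, (v != a) ==> (phi (lshift m a) < phi (lshift m v))].
  by apply: (right phi) => // v; apply/implyP.
rewrite negb_imply -leqNgt => /andP[ua leua].
have ltua : phi (lshift m u) < phi (lshift m a).
  rewrite ltn_neqAle leua andbT (inj_eq phiI) (inj_eq (@lshift_inj _ _)) //.
apply: (right (fun x => (n + m).+1 - phi x)); first exact: reflect_optimal.
  move=> v va; suff : phi (lshift m v) < phi (lshift m a).
    by have := phiB (lshift m v); have := phiB (lshift m a); lia.
  rewrite ltnNge leq_eqVlt (inj_eq phiI) (inj_eq (@lshift_inj _ _)) eq_sym (negbTE va) /=.
  by apply/negP => av; apply: (vertices_same_side phiO ua va); rewrite ltua.
by move=> v; rewrite /d /absd; have := phiB (lshift m v); have := phiB (lshift m a); lia.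
Qed.

End PendantClique.

(** * Running time and correctness of programs *)

(** The base [n.+1] is positive, so raising the exponent only weakens the bound, even at [n = 0]. *)
Definition poly (f : nat -> nat) := exists k, forall n, f n <= k * n.+1 ^ k.

Lemma poly_const c : poly (fun=> c).
Proof. by exists c => n; rewrite leq_pmulr // expn_gt0. Qed.

Lemma poly_id : poly id.
Proof. by exists 1 => n; rewrite mul1n expn1. Qed.

Lemma poly_add f g : poly f -> poly g -> poly (fun n => f n + g n).
Proof.
move=> [k fk] [l gl]; exists (k + l) => n; rewrite mulnDl leq_add //.
  by apply: leq_trans (fk n) _; rewrite leq_mul2l leq_pexp2l ?leq_addr ?orbT.
by apply: leq_trans (gl n) _; rewrite leq_mul2l leq_pexp2l ?leq_addl ?orbT.
Qed.

Lemma poly_mul f g : poly f -> poly g -> poly (fun n => f n * g n).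
Proof.
move=> [k fk] [l gl]; exists (k * l + (k + l)) => n.
apply: leq_trans (leq_mul (fk n) (gl n)) _.
by rewrite mulnACA -expnD; apply: leq_mul; rewrite ?leq_addr ?leq_pexp2l ?leq_addl.
Qed.

(** For positive [n], [n.+1 <= 2 * n] costs a factor [2 ^ k]; the case [n = 0] is absorbed by the
    additive constant. *)
Lemma poly_bound f : poly f -> exists k, forall n, f n <= k * n ^ k + k.
Proof.
move=> [k fk]; exists (k * 2 ^ k) => n; apply: leq_trans (fk n) _.
have k2 : k <= k * 2 ^ k by rewrite leq_pmulr // expn_gt0.
case: n => [|n]; first by rewrite exp1n muln1 (leq_trans k2) // leq_addl.
apply: leq_trans (leq_addr _ _).
apply: leq_trans (_ : k * (2 ^ k * n.+1 ^ k) <= _).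
  by rewrite leq_mul2l -expnMn; case: k {fk k2} => // k; rewrite leq_exp2r //; lia.
by rewrite mulnA leq_mul2l leq_pexp2l ?orbT.
Qed.

(* [B] bounds the number of iterations of every loop and the order of every
   graph given to the oracle. *)
Fixpoint cost (B : nat) (c : cmd) : nat :=
  match c with
  | Skip => 1
  | Seq c1 c2 => (cost B c1 + cost B c2).+1
  | Assign _ e => (ecost e).+1
  | Put _ e1 e2 e => (ecost e1 + ecost e2 + ecost e).+1
  | If e c1 c2 => (ecost e + (cost B c1 + cost B c2)).+1
  | While e c1 => B * (ecost e + cost B c1).+1 + (ecost e).+1
  | Call _ _ _ => (B * B).+1
  end.

Lemma poly_cost B c : poly B -> poly (fun n => cost (B n) c).
Proof.
move=> pB; have pS f : poly f -> poly (fun n => (f n).+1).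
  by move=> pf; apply: (poly_add (poly_const 1)).
elim: c => [|c1 IH1 c2 IH2|x e|b e1 e2 e|e c1 IH1 c2 IH2|e c1 IH1|x b b'] /=.
- exact: poly_const.
- exact/pS/poly_add.
- exact: poly_const.
- exact: poly_const.
- exact/pS/poly_add/poly_add/IH2/IH1/poly_const.
- apply: poly_add (poly_const _); apply: poly_mul => //.
  exact/pS/poly_add/IH1/poly_const.
- exact/pS/poly_mul.
Qed.

Fixpoint wvars (c : cmd) : seq nat :=
  match c with
  | Seq c1 c2 | If _ c1 c2 => wvars c1 ++ wvars c2
  | Assign x _ => [:: x]
  | While _ c1 => wvars c1
  | _ => [::]
  end.

Fixpoint wtabs (c : cmd) : seq nat :=
  match c with
  | Seq c1 c2 | If _ c1 c2 => wtabs c1 ++ wtabs c2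
  | Put b _ _ _ => [:: b]
  | While _ c1 => wtabs c1
  | Call _ _ b => [:: b]
  | _ => [::]
  end.

(** The written cells are found syntactically, so for concrete programs the side conditions are
    decided by computation. *)
Definition frame (c : cmd) (s s' : state) : Prop :=
  (forall x, x \notin wvars c -> vars s' x = vars s x) /\
  (forall b, b \notin wtabs c -> tabs s' b = tabs s b).

Lemma frame_trans c s1 s2 s3 : frame c s1 s2 -> frame c s2 s3 -> frame c s1 s3.
Proof.
by move=> [v1 t1] [v2 t2]; split=> x xc; rewrite ?v2 ?t2 // ?v1 ?t1.
Qed.

Lemma frame_sub c c' s s' : {subset wvars c <= wvars c'} ->
  {subset wtabs c <= wtabs c'} -> frame c s s' -> frame c' s s'.
Proof.
move=> sv st [fv ft]; split=> x xc.
  by apply: fv; apply: contra xc; apply: sv.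
by apply: ft; apply: contra xc; apply: st.
Qed.

Section Runs.
Variables (O : oracle) (B : nat).

Lemma exec_frame c s t s' : exec O c s t s' -> frame c s s'.
Proof.
elim=> {c s t s'} //.
- move=> c1 c2 s1 s2 s3 t1 t2 _ f1 _ f2; apply: (@frame_trans _ _ s2).
    by apply: frame_sub f1 => x /= h; rewrite mem_cat h.
  by apply: frame_sub f2 => x /= h; rewrite mem_cat h orbT.
- by move=> x e s; split=> //= y; rewrite inE => /negbTE->.
- by move=> b e1 e2 e s; split=> //= y; rewrite inE => /negbTE->.
- move=> e c1 c2 s t s' _ _; apply: frame_sub => x /= h; by rewrite mem_cat h.
- move=> e c1 c2 s t s' _ _; apply: frame_sub => x /= h; by rewrite mem_cat h orbT.
- by move=> e c s1 t1 s2 t2 s3 _ _ f1 _; apply: frame_trans.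
- by move=> x b b' s H _; split=> //= y; rewrite inE => /negbTE->.
Qed.

(** A total-correctness judgement with the syntactic time bound built in, so that correctness proofs
    yield running times as well. *)
Definition runs (c : cmd) (s : state) (Q : state -> Prop) : Prop :=
  exists t s', [/\ exec O c s t s', t <= cost B c & Q s'].

Lemma runs_frame c s (Q : state -> Prop) :
  runs c s (fun s' => frame c s s' -> Q s') -> runs c s Q.
Proof.
by move=> [t [s' [e tB q]]]; exists t, s'; split=> //; apply: q (exec_frame e).
Qed.

Lemma runs_conseq c s (P Q : state -> Prop) :
  runs c s P -> (forall s', P s' -> Q s') -> runs c s Q.
Proof.
by move=> [t [s' [e tB p]]] PQ; exists t, s'; split=> //; apply: PQ.
Qed.

Lemma runs_skip s (Q : state -> Prop) : Q s -> runs Skip s Q.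
Proof. by move=> q; exists 1, s; split=> //; constructor. Qed.

Lemma runs_seq c1 c2 s Q :
  runs c1 s (fun s1 => runs c2 s1 Q) -> runs (Seq c1 c2) s Q.
Proof.
move=> [t1 [s1 [e1 l1 [t2 [s2 [e2 l2 q]]]]]].
exists (t1 + t2).+1, s2; split=> //; first exact: ExecSeq e1 e2.
by rewrite /= ltnS leq_add.
Qed.

Lemma runs_assign x e s (Q : state -> Prop) :
  Q (set_var s x (eval s e)) -> runs (Assign x e) s Q.
Proof. by move=> q; eexists _, _; split; [apply: ExecAssign|..]. Qed.

Lemma runs_put b e1 e2 e s (Q : state -> Prop) :
  Q (set_tab s b (set_entry (tabs s b) (eval s e1) (eval s e2) (eval s e))) ->
  runs (Put b e1 e2 e) s Q.
Proof. by move=> q; eexists _, _; split; [apply: ExecPut|..]. Qed.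

Lemma runs_if e c1 c2 s Q :
  (eval s e != 0 -> runs c1 s Q) -> (eval s e = 0 -> runs c2 s Q) ->
  runs (If e c1 c2) s Q.
Proof.
move=> h1 h2; have [z|nz] := eqVneq (eval s e) 0.
  have [t [s' [ex l q]]] := h2 z; exists (ecost e + t).+1, s'; split=> //=.
    exact: ExecIfFalse.
  by rewrite ltnS leq_add2l (leq_trans l) ?leq_addl.
have [t [s' [ex l q]]] := h1 nz; exists (ecost e + t).+1, s'; split=> //=.
  exact: ExecIfTrue.
by rewrite ltnS leq_add2l (leq_trans l) ?leq_addr.
Qed.

(** [ExecCall] expects a graph of order [vars s x]; the equation with [n] lets a graph of known
    order be supplied without a cast. *)
Lemma runs_call x b b' s n (H : sgraph 'I_n) (Q : state -> Prop) :
  vars s x = n -> n <= B -> encodes_graph H (tabs s b) ->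
  Q (set_tab s b' (O H)) -> runs (Call x b b') s Q.
Proof.
move=> e; case: n / e H => H xB hH q.
eexists _, _; split; [exact: (ExecCall O b' hH)| |exact: q].
by rewrite /= ltnS leq_mul.
Qed.

Definition For r R c :=
  Seq (Assign r (Cst 0))
      (While (ESub R (Var r)) (Seq c (Assign r (EAdd (Var r) (Cst 1))))).

(** The bound [R] is evaluated anew before each pass, hence the demand that it equal [k] in every
    state differing from [s] only in cells that the loop writes. *)
Lemma runs_for r R c s k (I : nat -> state -> Prop) (Q : state -> Prop) :
  k <= B -> r \notin wvars c ->
  (forall s1, frame (For r R c) s s1 -> eval s1 R = k) ->
  I 0 (set_var s r 0) ->
  (forall i s1, i < k -> frame (For r R c) s s1 -> vars s1 r = i -> I i s1 ->
     runs c s1 (fun s2 => I i.+1 (set_var s2 r i.+1))) ->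
  (forall s1, frame (For r R c) s s1 -> I k s1 -> Q s1) ->
  runs (For r R c) s Q.
Proof.
move=> kB rc hR I0 step fin; apply: runs_seq; apply: runs_assign => /=.
set body := Seq c _; set w := While _ body.
(* Induction on the number [d] of passes left; [k <= B] enters only when the total time is compared
   with [cost]. *)
have loop d : forall i s1, i + d = k -> frame (For r R c) s s1 ->
    vars s1 r = i -> I i s1 -> exists t s', [/\ exec O w s1 t s',
      t <= d * (ecost (ESub R (Var r)) + cost B body).+1 +
           (ecost (ESub R (Var r))).+1 & Q s'].
  elim: d => [|d IH] i s1 ik fr ri Ii.
    rewrite addn0 in ik; exists (ecost (ESub R (Var r))).+1, s1; split=> //.
      by apply: ExecWhileFalse => /=; rewrite ri hR // ik subnn.
    by apply: fin => //; rewrite -ik.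
  have lt_ik : i < k by lia.
  have [t [s2 [ex l Ii1]]] := step i s1 lt_ik fr ri Ii.
  have fc := exec_frame ex.
  have r2 : vars s2 r = i by rewrite fc.1.
  pose s3 := set_var s2 r i.+1.
  have ex3 : exec O body s1 (t + (ecost (EAdd (Var r) (Cst 1))).+1).+1 s3.
    apply: ExecSeq ex _.
    have -> : s3 = set_var s2 r (eval s2 (EAdd (Var r) (Cst 1))).
      by rewrite /= r2 addn1.
    exact: ExecAssign.
  have fr3 : frame (For r R c) s s3.
    apply: frame_trans fr _; apply: frame_sub (exec_frame ex3) => x /=.
      by rewrite inE => ->; rewrite orbT.
    by [].
  have ik3 : i.+1 + d = k by rewrite addSnnS.
  have r3 : vars s3 r = i.+1 by rewrite /= eqxx.
  have [t' [s' [ex' l' q]]] := IH i.+1 s3 ik3 fr3 r3 Ii1.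
  have nz : eval s1 (ESub R (Var r)) != 0 by rewrite /= hR // ri; lia.
  have exw := ExecWhileTrue nz ex3 ex'.
  eexists; exists s'; split; [exact: exw| |exact: q].
  rewrite mulSn; move: l l'; rewrite /body /=; set X := d * _; lia.
have [||t [s' [ex l q]]] := loop k 0 (set_var s r 0) (add0n k) _ _ I0.
- by split=> //= x; rewrite inE => /norP[/negbTE->].
- by rewrite /= eqxx.
exists t, s'; split=> //; apply: leq_trans l _.
by rewrite /= leq_add2r leq_mul2r kB orbT.
Qed.

(** The command [c] prepares the summand [e], which allows nested sums; [Fill] uses its command in
    the same way. *)
Definition Sum x r R c e :=
  Seq (Assign x (Cst 0)) (For r R (Seq c (Assign x (EAdd (Var x) e)))).

Lemma runs_sum x r R c e s k (f : nat -> nat) (Q : state -> Prop) :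
  k <= B -> r != x -> r \notin wvars c -> x \notin wvars c ->
  (forall s1, frame (Sum x r R c e) s s1 -> eval s1 R = k) ->
  (forall i s1, i < k -> frame (Sum x r R c e) s s1 -> vars s1 r = i ->
     runs c s1 (fun s2 => eval s2 e = f i)) ->
  (forall s1, frame (Sum x r R c e) s s1 -> vars s1 x = \sum_(i < k) f i -> Q s1) ->
  runs (Sum x r R c e) s Q.
Proof.
move=> kB rx rc xc hR body fin; apply: runs_seq; apply: runs_assign.
set s0 := set_var s x _; set c' := Seq c _.
have f0 : frame (Sum x r R c e) s s0.
  by split=> //= y; rewrite inE => /norP[/negbTE->].
have up s1 : frame (For r R c') s0 s1 -> frame (Sum x r R c e) s s1.
  move=> fr; apply: frame_trans f0 _; apply: frame_sub fr => //.
  by move=> y h; rewrite inE; apply/orP; right.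
apply: (runs_for (k := k) (I := fun i s1 => vars s1 x = \sum_(j < i) f j)) => //.
- by rewrite /= mem_cat inE negb_or rc.
- by move=> s1 /up/hR.
- by rewrite /s0 /= eqxx eq_sym (negbTE rx) big_ord0.
- move=> i s1 ik /up fr ri Ii; apply: runs_seq; apply: runs_frame.
  apply: runs_conseq (body i s1 ik fr ri) _ => s2 ev fc.
  apply: runs_assign; rewrite /= eqxx eq_sym (negbTE rx) ev fc.1 // Ii.
  by rewrite big_ord_recr.
- by move=> s1 /up fr Ik; apply: fin.
Qed.

Definition Fill b e1 r R c e := For r R (Seq c (Put b e1 (Var r) e)).

Lemma runs_fill b e1 r R c e s row k (f : nat -> nat) (Q : state -> Prop) :
  k <= B -> r \notin wvars c -> b \notin wtabs c ->
  (forall s1, frame (Fill b e1 r R c e) s s1 -> eval s1 R = k) ->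
  (forall i s1, i < k -> frame (Fill b e1 r R c e) s s1 -> vars s1 r = i ->
     runs c s1 (fun s2 => eval s2 e = f i /\ eval s2 e1 = row)) ->
  (forall s1, frame (Fill b e1 r R c e) s s1 ->
     (forall i j, tabs s1 b i j =
        if (i == row) && (j < k) then f j else tabs s b i j) -> Q s1) ->
  runs (Fill b e1 r R c e) s Q.
Proof.
move=> kB rc bc hR body fin.
apply: (runs_for (k := k) (I := fun i0 s1 => forall i j, tabs s1 b i j =
        if (i == row) && (j < i0) then f j else tabs s b i j)) => //.
- by rewrite /= cats0.
- by move=> i j; rewrite andbF.
move=> i0 s1 ik fr ri Ii; apply: runs_seq; apply: runs_frame.
apply: runs_conseq (body i0 s1 ik fr ri) _ => s2 [ev erow] fc.
apply: runs_put => i j; rewrite /= eqxx /set_entry erow ev fc.1 // ri fc.2 // Ii.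
have [->|_] := eqVneq i row => //=.
have [->|ji] := eqVneq j i0; first by rewrite ltnSn.
by have -> : (j < i0.+1) = (j < i0) by lia.
Qed.

Definition Fill2 b r1 R1 r2 R2 e := For r1 R1 (Fill b (Var r1) r2 R2 Skip e).

Lemma runs_fill2 b r1 R1 r2 R2 e s k1 k2 (f : nat -> nat -> nat)
    (Q : state -> Prop) :
  k1 <= B -> k2 <= B -> r1 != r2 ->
  (forall s1, frame (Fill2 b r1 R1 r2 R2 e) s s1 -> eval s1 R1 = k1) ->
  (forall s1, frame (Fill2 b r1 R1 r2 R2 e) s s1 -> eval s1 R2 = k2) ->
  (forall i j s1, i < k1 -> j < k2 -> frame (Fill2 b r1 R1 r2 R2 e) s s1 ->
     vars s1 r1 = i -> vars s1 r2 = j -> eval s1 e = f i j) ->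
  (forall s1, frame (Fill2 b r1 R1 r2 R2 e) s s1 ->
     (forall i j, i < k1 -> j < k2 -> tabs s1 b i j = f i j) -> Q s1) ->
  runs (Fill2 b r1 R1 r2 R2 e) s Q.
Proof.
move=> k1B k2B r12 h1 h2 body fin.
apply: (runs_for (k := k1) (I := fun i0 s1 => forall i j, i < i0 -> j < k2 ->
          tabs s1 b i j = f i j)) => //.
  by rewrite /= !inE orbb.
move=> i0 s1 ik fr ri Ii.
have up s2 : frame (Fill b (Var r1) r2 R2 Skip e) s1 s2 ->
    frame (Fill2 b r1 R1 r2 R2 e) s s2.
  move=> fr'; apply: frame_trans fr _; apply: frame_sub fr' => //.
  by move=> y; rewrite /= !inE orbb => ->; rewrite orbT.
apply: (@runs_fill _ _ _ _ _ _ _ i0 k2 (f i0)) => //.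
- by move=> s2 /up/h2.
- move=> j s2 jk fr2 rj; apply: runs_skip.
  have r1i : vars s2 r1 = i0 by rewrite fr2.1 //= !inE orbb.
  by split; [apply: body => //; apply: up | rewrite /= r1i].
move=> s2 fr2 h i j; rewrite ltnS leq_eqVlt /= h => /orP[/eqP->|ii] jk.
  by rewrite eqxx jk.
by rewrite ltn_eqF //= Ii.
Qed.

End Runs.

(** Truth values are numbers: every positive value counts as true, and the connectives return 0 or
    1. Hence [eDist] can serve as a test for being different. *)
Definition eNot e := ESub (Cst 1) e.
Definition eAnd e f := eNot (EAdd (eNot e) (eNot f)).
Definition eOr e f := eNot (eNot (EAdd e f)).
Definition eLe e f := eNot (ESub e f).
Definition eLt e f := eLe (EAdd e (Cst 1)) f.
Definition eEq e f := eNot (EAdd (ESub e f) (ESub f e)).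
Definition eDist e f := EAdd (ESub e f) (ESub f e).
Arguments eNot : simpl never.
Arguments eAnd : simpl never.
Arguments eOr : simpl never.
Arguments eLe : simpl never.
Arguments eLt : simpl never.
Arguments eEq : simpl never.

Lemma eval_and s e f : eval s (eAnd e f) = (0 < eval s e) && (0 < eval s f).
Proof. by rewrite /eAnd /eNot /=; lia. Qed.
Lemma eval_or s e f : eval s (eOr e f) = (0 < eval s e) || (0 < eval s f).
Proof. by rewrite /eOr /eNot /=; lia. Qed.
Lemma eval_le s e f : eval s (eLe e f) = (eval s e <= eval s f).
Proof. by rewrite /eLe /eNot /=; lia. Qed.
Lemma eval_lt s e f : eval s (eLt e f) = (eval s e < eval s f).
Proof. by rewrite /eLt eval_le /= addn1. Qed.
Lemma eval_eq s e f : eval s (eEq e f) = (eval s e == eval s f).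
Proof. by rewrite /eEq /eNot /=; lia. Qed.
Definition evalE := (eval_and, eval_or, eval_le, eval_lt, eval_eq, lt0b).

(** * The two programs *)

Section RelGraph.
Variables (N : nat) (r : rel nat).
Hypotheses (r_sym : symmetric r) (r_irr : irreflexive r).

Let E : {set {set 'I_N}} :=
  [set e | [exists i : 'I_N, exists j : 'I_N,
             [&& i != j, e == [set i; j] & r i j]]].

Fact rel_graph_edgesP : [forall e in E, #|e| == 2].
Proof.
apply/forall_inP => e; rewrite inE => /existsP[i /existsP[j /and3P[ij /eqP-> _]]].
by rewrite cards2 ij.
Qed.

Definition rel_graph : sgraph 'I_N := SGraph rel_graph_edgesP.

Lemma adj_rel_graph i j : adj rel_graph i j = r i j.
Proof.
rewrite /adj /rel_graph /= inE; apply/existsP/idP.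
  case=> k /existsP[l /and3P[kl /eqP e rkl]].
  have: k \in [set i; j] by rewrite e !inE eqxx.
  have: l \in [set i; j] by rewrite e !inE eqxx orbT.
  rewrite !inE => /orP[] /eqP el /orP[] /eqP ek; subst => //.
  - by rewrite eqxx in kl.
  - by rewrite r_sym.
  - by rewrite eqxx in kl.
move=> rij; exists i; apply/existsP; exists j; rewrite eqxx rij !andbT.
by apply: contraTneq rij => ->; rewrite r_irr.
Qed.

Lemma rel_graph_encodes (M : table) :
  (forall i j, i < N -> j < N -> M i j = r i j) -> encodes_graph rel_graph M.
Proof. by move=> h i j; rewrite h // -adj_rel_graph. Qed.

End RelGraph.

(** Extends adjacency to all numbers by false, in the very form of the input table, so that
    [tab0_initial] holds by conversion. *)
Definition nat_adj n (G : sgraph 'I_n) (i j : nat) : bool :=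
  [exists u : 'I_n, exists v : 'I_n, [&& val u == i, val v == j & adj G u v]].

Section NatAdj.
Variables (n : nat) (G : sgraph 'I_n).

Lemma nat_adj_ord (u v : 'I_n) : nat_adj G u v = adj G u v.
Proof.
apply/existsP/idP => [[u' /existsP[v' /and3P[/eqP/val_inj-> /eqP/val_inj->]]] //|uv].
by exists u; apply/existsP; exists v; rewrite !eqxx.
Qed.

Lemma nat_adj_lt i j : nat_adj G i j -> (i < n) && (j < n).
Proof. by case/existsP=> u /existsP[v /and3P[/eqP<- /eqP<- _]]; rewrite !ltn_ord. Qed.

Lemma nat_adj_sym : symmetric (nat_adj G).
Proof.
move=> i j; apply/existsP/existsP => -[u /existsP[v /and3P[ui vj uv]]];
  by exists v; apply/existsP; exists u; rewrite ui vj adjC.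
Qed.

Lemma nat_adj_irr : irreflexive (nat_adj G).
Proof.
move=> i; case h: (nat_adj G i i) => //; have /andP[ilt _] := nat_adj_lt h.
by have := nat_adj_ord (Ordinal ilt) (Ordinal ilt); rewrite adjnn /= h.
Qed.

End NatAdj.

Lemma tab0_initial n (G : sgraph 'I_n) i j :
  tabs (initial_state G) 0 i j = nat_adj G i j.
Proof. by []. Qed.

(** The rows list each member once in an unknown order, on which a column sum does not depend. *)
Lemma sum_encodes_family N (L : {set {set 'I_N}}) M (v : 'I_N) :
  encodes_family L M -> \sum_(i < #|L|) M i v = \sum_(X in L) (v \in X).
Proof.
case=> F [uF FL MF].
have sF : size F = #|L| by rewrite -(card_uniqP uF); apply: eq_card.
have pF : perm_eq F (enum L).
  by apply: uniq_perm; rewrite ?enum_uniq // => X; rewrite FL mem_enum.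
rewrite -[RHS]big_enum -(perm_big _ pF) /= (big_nth set0) sF big_mkord.
by apply: eq_bigr => i _; rewrite MF // sF.
Qed.

Notation "c1 ;; c2" := (Seq c1 c2) (at level 90, right associativity).

Definition clique_rel n i j := [&& n <= i, n <= j & i != j].

(* Variables: 1 order of the auxiliary graph, 5 number of members of the
   answer.  Tables: 2 auxiliary graph, 3 answer of the oracle, 4 number of
   members containing each vertex. *)
Definition arrangement_program : cmd :=
  Assign 1 (EAdd (Var 0) (EAdd (Var 0) (Cst 1))) ;;
  Fill2 2 2 (Var 1) 3 (Var 1)
    (eOr (Get 0 (Var 2) (Var 3))
         (eAnd (eLe (Var 0) (Var 2))
               (eAnd (eLe (Var 0) (Var 3)) (eDist (Var 2) (Var 3))))) ;;
  Call 1 2 3 ;;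
  Assign 5 (ESub (EAdd (Var 1) (Var 1)) (Cst 1)) ;;
  Fill 4 (Cst 0) 2 (Var 0)
    (Sum 4 3 (Var 5) Skip (Get 3 (Var 3) (Var 2))) (Var 4) ;;
  Fill 1 (Cst 0) 2 (Var 0)
    (Sum 4 3 (Var 0) Skip
       (eLe (Get 4 (Cst 0) (Var 2)) (Get 4 (Cst 0) (Var 3)))) (Var 4).

Lemma card_tree_of n (phi : 'I_n -> nat) :
  linear_arrangement phi -> #|tree_of phi| = n + n - 1.
Proof.
move=> phiA; rewrite -sum1_card (sum_tree_of (fun=> 1)) //.
by rewrite sum_nat_const sum_nat_const_nat card_ord; lia.
Qed.

Lemma absd_gt0 x y : (0 < absd x y) = (x != y).
Proof. by rewrite /absd; lia. Qed.

(** The longest loop runs over the [N + N - 1 = 4 * n + 1] members of a reassembling of the union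
    with a clique on [n.+1] vertices. *)
Lemma arrangement_program_correct O n (G : sgraph 'I_n) :
  solves O optimal_reassembling_problem ->
  runs O (4 * n + 2) arrangement_program (initial_state G)
    (fun s => optimal_arrangement_problem G (tabs s 1)).
Proof.
move=> solO; pose N := n + n.+1.
apply: runs_seq; apply: runs_assign => /=.
set s1 := set_var _ _ _.
have NE : n + (n + 1) = N by rewrite addn1.
pose r : rel nat := fun i j => nat_adj G i j || clique_rel n i j.
apply: runs_seq; apply: (@runs_fill2 _ _ _ _ _ _ _ _ _ N N (fun i j => r i j)) => //.
- by lia.
- by lia.
- by move=> s [fv _]; rewrite /= fv.
- by move=> s [fv _]; rewrite /= fv.
- move=> i j s _ _ [fv ft] si sj.
  by rewrite !evalE /= si sj fv //= ft // tab0_initial -/(absd i j) absd_gt0 lt0b.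
move=> s2 [fv2 ft2] tab2.
have r_sym : symmetric r.
  by move=> i j; rewrite /r nat_adj_sym /clique_rel eq_sym andbCA.
have r_irr : irreflexive r.
  by move=> i; rewrite /r nat_adj_irr /clique_rel eqxx !andbF.
pose H := rel_graph N r.
apply: runs_seq; apply: (@runs_call _ _ _ _ _ _ N H).
- by rewrite fv2.
- by lia.
- by apply: rel_graph_encodes; last exact: tab2.
have [L LO LM] := solO _ H; have [/linear_binary_treeP[phi phiA LE] _] := LO.
subst L; have cardL := card_tree_of phiA.
set M := O N H in LM *; set s3 := set_tab _ _ _.
apply: runs_seq; apply: runs_assign; set s4 := set_var _ _ _.
have s4R : vars s4 5 = N + N - 1 by rewrite /= !fv2 //= NE.
have s4n : vars s4 0 = n by rewrite /= fv2.
apply: runs_seq.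
apply: (@runs_fill _ _ _ _ _ _ _ _ _ 0 n
         (fun v => \sum_(i < N + N - 1) M i v)) => //.
- by lia.
- by move=> s [fv _]; rewrite /= fv.
- move=> v s vn [fv ft] sv.
  apply: (@runs_sum _ _ _ _ _ _ _ _ (N + N - 1) (fun i => M i v)) => //.
  + by lia.
  + by move=> s' [fv' _]; rewrite /= fv' // fv.
  + move=> i s' iN [fv' ft'] s'i; apply: runs_skip.
    by rewrite /= s'i ft' // ft // fv' // sv.
move=> s5 [fv5 ft5] tab5.
have lt_nm : n < n.+1 by [].
have Hll u v : adj H (lshift n.+1 u) (lshift n.+1 v) = adj G u v.
  rewrite adj_rel_graph // /r /= nat_adj_ord /clique_rel.
  by rewrite leqNgt ltn_ord /= orbF.
have Hlr u k : adj H (lshift n.+1 u) (rshift n k) = false.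
  rewrite adj_rel_graph // /r /= /clique_rel leqNgt ltn_ord /= orbF.
  by case e: nat_adj => //; have := nat_adj_lt e; lia.
have Hrr k l : adj H (rshift n k) (rshift n l) = (k != l).
  rewrite adj_rel_graph // /r /= /clique_rel !leq_addr eqn_add2l /=.
  by case e: nat_adj => //; have := nat_adj_lt e; lia.
have count v : \sum_(i < N + N - 1) M i (lshift n.+1 v) =
    N.+2 - phi (lshift n.+1 v).
  rewrite -cardL (sum_encodes_family _ LM).
  exact: (membership_count lt_nm Hll Hlr Hrr phiA LO).
pose psi := rank (phi \o @lshift n n.+1).
(* A larger membership count means an earlier position, so the comparison of counts is reversed. *)
apply: (@runs_fill _ _ _ _ _ _ _ _ _ 0 n
         (fun v => \sum_(u < n) (tabs s5 4 0 v <= tabs s5 4 0 u))) => //.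
- by lia.
- by move=> s [fv _]; rewrite /= fv // fv5.
- move=> v s vn [fv ft] sv.
  apply: (@runs_sum _ _ _ _ _ _ _ _ n
           (fun u => tabs s5 4 0 v <= tabs s5 4 0 u : nat)) => //.
  + by lia.
  + by move=> s' [fv' _]; rewrite /= fv' // fv // fv5.
  + move=> i s' iN [fv' ft'] s'i; apply: runs_skip.
    by rewrite evalE /= s'i ft' // ft // fv' // sv.
move=> s6 [fv6 ft6] tab6.
exists psi; first exact: (restricted_rank_optimal lt_nm Hll Hlr Hrr phiA LO).
move=> v; rewrite tab6 ltn_ord eqxx /= /psi rankE; apply: eq_bigr => u _.
rewrite !tab5 !ltn_ord eqxx /=.
have := count u; have := count v => /= -> ->.
have [_ phiB _] := phiA; rewrite card_ord in phiB.
have := phiB (lshift n.+1 v); have := phiB (lshift n.+1 u).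
by rewrite -/N; lia.
Qed.

(** * Reassembling from arrangement *)

Definition link_rel n a i j := [&& i < n, n <= j & (i == a) || (j == n)].

Definition eLink i j :=
  eAnd (eLt i (Var 0))
       (eAnd (eLe (Var 0) j) (eOr (eEq i (Var 6)) (eEq j (Var 0)))).

Definition eDistFrom x := eDist (Get 3 (Cst 0) x) (Get 3 (Cst 0) (Var 6)).

(* Variables: 1 order of the auxiliary graph, 6 the vertex [a], 12 cost of the
   candidate.  Tables: 2 auxiliary graph, 3 answer of the oracle, 4 candidate
   arrangements, the one starting at [a] in row [a]. *)
Definition candidate_program : cmd :=
  Fill2 2 2 (Var 1) 3 (Var 1)
    (eOr (eOr (Get 0 (Var 2) (Var 3))
              (eAnd (eLe (Var 0) (Var 2))
                    (eAnd (eLe (Var 0) (Var 3)) (eDist (Var 2) (Var 3)))))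
         (eOr (eLink (Var 2) (Var 3)) (eLink (Var 3) (Var 2)))) ;;
  Call 1 2 3 ;;
  Fill 4 (Var 6) 2 (Var 0)
    (Sum 4 3 (Var 0) Skip (eLe (eDistFrom (Var 3)) (eDistFrom (Var 2))))
    (Var 4) ;;
  Sum 12 7 (ESub (Var 0) (Cst 1))
    (Sum 9 2 (Var 0)
       (Sum 4 3 (Var 0) Skip
          (eAnd (eAnd (Get 0 (Var 2) (Var 3))
                      (eLe (Get 4 (Var 6) (Var 2)) (EAdd (Var 7) (Cst 2))))
                (eLt (EAdd (Var 7) (Cst 2)) (Get 4 (Var 6) (Var 3)))))
       (Var 4))
    (Var 9).

(* Variables 10 and 11 hold the best [a] so far and its cost; for [a = 0] the
   test [1 - a] forces the update.  Output rows below [n] are the singletons,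
   row [n + k] is the prefix of length [k + 2]. *)
Definition reassembling_program : cmd :=
  Sum 5 2 (EAdd (Var 0) (Cst 1)) Skip (EAdd (Var 0) (Cst 1)) ;;
  Sum 4 2 (EAdd (Var 0) (Cst 1)) Skip (Var 5) ;;
  Assign 1 (EAdd (Var 0) (Var 4)) ;;
  For 6 (Var 0)
    (candidate_program ;;
     If (EAdd (ESub (Cst 1) (Var 6)) (ESub (Var 11) (Var 12)))
       (Assign 11 (Var 12) ;; Assign 10 (Var 6)) Skip) ;;
  Fill2 1 2 (EAdd (Var 0) (Var 0)) 3 (Var 0)
    (eOr (eAnd (eLt (Var 2) (Var 0)) (eEq (Var 2) (Var 3)))
         (eAnd (eLe (Var 0) (Var 2))
               (eLe (Get 4 (Var 10) (Var 3))
                    (EAdd (ESub (Var 2) (Var 0)) (Cst 2))))).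

(** This cube satisfies [m_big] and can be computed by repeated addition. *)
Definition clique_size n := n.+1 * (n.+1 * n.+1).

(** The index [k + 2] and the three nested sums match the loops of [candidate_program]. *)
Lemma gap_costE n (G : sgraph 'I_n) (psi : nat -> nat) :
  gap_cost G (fun v => psi v) =
  \sum_(k < n - 1) \sum_(u < n) \sum_(v < n)
    (nat_adj G u v && (psi u <= k + 2) && (k + 2 < psi v)).
Proof.
rewrite /gap_cost card_ord -{1}[2]add0n big_addn subSS.
rewrite big_mkord; apply: eq_bigr => k _; rewrite degE.
apply: eq_bigr => u _; apply: eq_bigr => v _.
by rewrite nat_adj_ord !inE -ltnNge.
Qed.

(** Rows other than [a] of table 4 are preserved, so the best candidate found earlier survives. *)
Lemma candidate_program_correct O n (G : sgraph 'I_n) (a : 'I_n) s :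
  solves O optimal_arrangement_problem ->
  vars s 0 = n -> vars s 1 = n + clique_size n -> vars s 6 = a ->
  (forall i j, tabs s 0 i j = nat_adj G i j) ->
  runs O (n + clique_size n) candidate_program s (fun s' =>
    exists2 psi : 'I_n -> nat,
      [/\ linear_arrangement psi, psi a = 1 &
          forall chi, linear_arrangement chi -> chi a = 1 ->
            edge_cost G psi <= edge_cost G chi] &
      [/\ vars s' 12 = gap_cost G psi, forall v : 'I_n, tabs s' 4 a v = psi v &
          forall i j : nat, i != a -> tabs s' 4 i j = tabs s 4 i j]).
Proof.
move=> solO s_n s_N s_a s_G; set m := clique_size n in s_N *.
(* [link_rel] covers only the orientation from [G] to the clique, whose hub has number [n]; both
   orders are included for symmetry. *)
pose r : rel nat := fun i j =>
  (nat_adj G i j || clique_rel n i j) || (link_rel n a i j || link_rel n a j i).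
have m_big : n * (n * n) + n * n < m by rewrite /m /clique_size; nia.
apply: runs_seq.
apply: (@runs_fill2 _ _ _ _ _ _ _ _ _ (n + m) (n + m) (fun i j => r i j)) => //.
- by move=> s1 [fv _]; rewrite /= fv.
- by move=> s1 [fv _]; rewrite /= fv.
- move=> i j s1 _ _ [fv ft] si sj.
  rewrite /eLink !evalE /= si sj !fv //= s_n s_a ft // s_G.
  by rewrite -/(absd i j) absd_gt0 lt0b.
move=> s2 [fv2 ft2] tab2.
have r_sym : symmetric r.
  move=> i j; rewrite /r nat_adj_sym /clique_rel eq_sym andbCA.
  by congr (_ || _); rewrite orbC.
have r_irr : irreflexive r.
  by move=> i; rewrite /r nat_adj_irr /clique_rel /link_rel; lia.
pose H := rel_graph (n + m) r.
have Hll u v : adj H (lshift m u) (lshift m v) = adj G u v.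
  rewrite adj_rel_graph // /r /= nat_adj_ord /clique_rel /link_rel.
  by rewrite (leqNgt n u) (leqNgt n v) !ltn_ord /= !orbF.
have Hlr u (k : 'I_m) : adj H (lshift m u) (rshift n k) = (u == a) || (val k == 0).
  rewrite adj_rel_graph // /r /= /clique_rel /link_rel -(inj_eq val_inj) /=.
  have := ltn_ord u; case e: nat_adj; first by have := nat_adj_lt e; lia.
  by lia.
have Hrr k l : adj H (rshift n k) (rshift n l) = (k != l).
  rewrite adj_rel_graph // /r /= /clique_rel /link_rel -(inj_eq val_inj) /=.
  case e: nat_adj; first by have := nat_adj_lt e; lia.
  by lia.
apply: runs_seq; apply: (@runs_call _ _ _ _ _ _ (n + m) H) => //.
- by rewrite fv2.
- by apply: rel_graph_encodes; last exact: tab2.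
have [phi phiO phiM] := solO _ H.
set M := O _ H in phiM *; set s3 := set_tab _ _ _.
(* The distances and ranks of [distance_rank_optimal], restated on numbers as the program computes
   them. *)
pose d v := absd (M 0 v) (M 0 a).
pose psi0 v := \sum_(u < n) (d u <= d v).
have [] := distance_rank_optimal m_big Hll Hlr Hrr phiO.
set psi := rank _ => d_inj psi_a psi_opt.
have psi0E v : psi0 (val v) = psi v.
  rewrite /psi0 /psi rankE; apply: eq_bigr => u _; rewrite /d.
  have := phiM (lshift m u); have := phiM (lshift m v); have := phiM (lshift m a).
  by move=> /= -> -> ->.
have psiA : linear_arrangement psi by apply: rank_linear_arrangement.
apply: runs_seq; apply: (@runs_fill _ _ _ _ _ _ _ _ _ a n psi0) => //.
- by rewrite leq_addr.
- by move=> s4 [fv _]; rewrite /= fv //= fv2.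
- move=> v s4 vn [fv ft] sv.
  have s4a : vars s4 6 = a by rewrite fv //= fv2.
  apply: (@runs_sum _ _ _ _ _ _ _ _ n (fun u => d u <= d v : nat)) => //.
  + by rewrite leq_addr.
  + by move=> s5 [fv' _]; rewrite /= fv' // fv //= fv2.
  + move=> i s5 iN [fv' ft'] s5i; apply: runs_skip.
    by rewrite evalE /= s5i ft' // ft // !fv' // sv s4a.
  + by move=> s5 [fv' _] s5s /=; split=> //; rewrite fv'.
move=> s4 [fv4 ft4] tab4.
have s4a : vars s4 6 = a by rewrite fv4 //= fv2.
have s4n : vars s4 0 = n by rewrite fv4 //= fv2.
have s4G i j : tabs s4 0 i j = nat_adj G i j by rewrite ft4 //= ft2.
pose F k u v : nat := nat_adj G u v && (psi0 u <= k + 2) && (k + 2 < psi0 v).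
apply: (@runs_sum _ _ _ _ _ _ _ _ (n - 1)
         (fun k => \sum_(u < n) \sum_(v < n) F k u v)) => //.
- by lia.
- by move=> s5 [fv _]; rewrite /= fv // s4n.
- move=> k s5 kn [fv5 ft5] s5k.
  apply: (@runs_sum _ _ _ _ _ _ _ _ n (fun u => \sum_(v < n) F k u v)) => //.
  + by rewrite leq_addr.
  + by move=> s6 [fv _]; rewrite /= fv // fv5.
  + move=> u s6 un [fv6 ft6] s6u.
    apply: (@runs_sum _ _ _ _ _ _ _ _ n (fun v => F k u v)) => //.
    * by rewrite leq_addr.
    * by move=> s7 [fv _]; rewrite /= fv // fv6 // fv5.
    * move=> v s7 vn [fv7 ft7] s7v; apply: runs_skip.
      rewrite !evalE /= s7v !fv7 // s6u !fv6 // s5k fv5 // s4a.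
      rewrite !ft7 // !ft6 // !ft5 // s4G !tab4 eqxx un vn.
      by rewrite lt0b.
move=> s5 [fv5 ft5] s5c; exists psi; split=> //.
- rewrite s5c -gap_costE; apply: eq_bigr => k _.
  by congr deg; apply/setP => v; rewrite !inE psi0E.
- by move=> v; rewrite ft5 // tab4 eqxx ltn_ord /= psi0E.
- by move=> i j /negbTE ia; rewrite ft5 // tab4 ia /= ft2.
Qed.

(** The bound is the order of the auxiliary graphs, which dominates the length of every loop. *)
Lemma reassembling_program_correct O n (G : sgraph 'I_n) :
  solves O optimal_arrangement_problem ->
  runs O (n + clique_size n) reassembling_program (initial_state G)
    (fun s => optimal_reassembling_problem G (tabs s 1)).
Proof.
move=> solO; have nB : n.+1 <= n + clique_size n by rewrite /clique_size; nia.
(* Two rounds of repeated addition compute the square and then the cube of [n.+1]. *)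
apply: runs_seq; apply: (@runs_sum _ _ _ _ _ _ _ _ n.+1 (fun=> n.+1)) => //.
- by move=> s [fv _]; rewrite /= fv //= addn1.
- by move=> i s _ [fv _] _; apply: runs_skip; rewrite /= fv //= addn1.
move=> s1 [fv1 ft1]; rewrite sum_nat_const card_ord => s1_5.
apply: runs_seq; apply: (@runs_sum _ _ _ _ _ _ _ _ n.+1 (fun=> n.+1 * n.+1)) => //.
- by move=> s [fv _]; rewrite /= fv //= fv1 //= addn1.
- by move=> i s _ [fv _] _; apply: runs_skip; rewrite /= fv.
move=> s2 [fv2 ft2]; rewrite sum_nat_const card_ord -/(clique_size n) => s2_4.
apply: runs_seq; apply: runs_assign; set s3 := set_var _ _ _.
have s3_0 : vars s3 0 = n by rewrite /= fv2 //= fv1.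
have s3_1 : vars s3 1 = n + clique_size n by rewrite /= s2_4 fv2 //= fv1.
have s3G i j : tabs s3 0 i j = nat_adj G i j by rewrite /= ft2 //= ft1.
(* The loop invariant: the stored candidate is best among the arrangements whose first vertex is
   below [i]. It is vacuous at 0, where nothing is stored yet. *)
pose best i (s : state) := 0 < i ->
  vars s 10 < i /\ exists2 psi : 'I_n -> nat,
    (forall v : 'I_n, tabs s 4 (vars s 10) v = psi v) /\ linear_arrangement psi &
    vars s 11 = gap_cost G psi /\
    forall chi (a : 'I_n), linear_arrangement chi -> chi a = 1 -> a < i ->
      vars s 11 <= gap_cost G chi.
apply: runs_seq; apply: (@runs_for _ _ _ _ _ _ n best) => //.
- exact: ltnW.
- by move=> s [fv _]; rewrite /= fv.
- move=> a s an [fv ft] sa bs.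
  apply: runs_seq; apply: runs_frame.
  apply: runs_conseq
    (@candidate_program_correct O n G (Ordinal an) s solO _ _ _ _) _ => //.
  + by rewrite fv.
  + by rewrite fv.
  + by move=> i j; rewrite ft.
  move=> s4 [psi [psiA psia psiO] [s4_12 s4psi s4old]] [fv4 ft4].
  (* With the first vertex fixed, edge cost and gap cost differ by a constant, so minimizing one
     minimizes the other. *)
  have psi_opt chi : linear_arrangement chi -> chi (Ordinal an) = 1 ->
      gap_cost G psi <= gap_cost G chi.
    move=> chiA chia; have := psiO chi chiA chia.
    by rewrite (edge_cost_gap G psiA psia) (edge_cost_gap G chiA chia) leq_add2l.
  have split_a (b : 'I_n) : b < a.+1 -> b < a \/ b = Ordinal an.
    rewrite ltnS leq_eqVlt => /orP[/eqP e|]; last by left.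
    by right; apply: val_inj.
  have s4_6 : vars s4 6 = a by rewrite fv4.
  (* An update happens when [a = 0] or when the new cost is strictly smaller than the stored one. *)
  apply: runs_if => /= [upd|keep].
    apply: runs_seq; apply: runs_assign; apply: runs_assign => _ /=.
    rewrite s4_6; split=> //; exists psi => //; rewrite s4_12; split=> //.
    move=> chi b chiA chib /split_a[ba|eb]; last by apply: psi_opt; rewrite // -eb.
    have a0 : 0 < a by apply: leq_ltn_trans ba.
    have [_ [psi' _ [_ opt']]] := bs a0.
    have := opt' chi b chiA chib ba; rewrite -(fv4 11) //.
    by move: upd; rewrite s4_6 s4_12; lia.
  have a0 : 0 < a by lia.
  have [s10 [psi' [tab' psi'A] [s11 opt']]] := bs a0.
  apply: runs_skip => _ /=; rewrite !(fv4 10) // !(fv4 11) //.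
  split; first exact: ltnW.
  exists psi'; split=> //.
    by move=> v; rewrite s4old -?tab' //= ltn_eqF.
  move=> chi b chiA chib /split_a[ba|eb]; first exact: (opt' chi b).
  rewrite eb in chib; apply: leq_trans (psi_opt _ chiA chib).
  by move: keep; rewrite s4_12 (fv4 11) // s11; lia.
move=> s4 [fv4 ft4] best4; have s4n : vars s4 0 = n by rewrite fv4.
pose row i v : nat :=
  (i < n) && (i == v) || (n <= i) && (tabs s4 4 (vars s4 10) v <= i - n + 2).
apply: (@runs_fill2 _ _ _ _ _ _ _ _ _ (n + n) n row) => //.
- by rewrite leq_add2l /clique_size; nia.
- by lia.
- by move=> s [fv _]; rewrite /= fv // s4n.
- by move=> s [fv _]; rewrite /= fv.
- move=> i j s _ _ [fv ft] si sj.
  by rewrite !evalE /= si sj !fv // s4n ft //.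
move=> s5 [fv5 ft5] tab5.
have [psi [psi_tab psiA] psi_opt] : exists2 psi : 'I_n -> nat,
    (forall v : 'I_n, tabs s4 4 (vars s4 10) v = psi v) /\ linear_arrangement psi &
    forall chi, linear_arrangement chi -> gap_cost G psi <= gap_cost G chi.
  (* For [n = 0] the loop stores no candidate, but any row is then an arrangement and all gap costs
     vanish. *)
  have [n0|n0] := posnP n.
    exists (tabs s4 4 (vars s4 10)); first split=> //.
      by apply: inj_linear_arrangement => v; have := ltn_ord v; rewrite {2}n0.
    by move=> chi _; rewrite /gap_cost card_ord big_geq // n0.
  have [_ [psi [psi_tab psiA] [s11 opt]]] := best4 n0.
  exists psi => // chi chiA; have [|a chia] := linear_arrangement_first chiA.
    by rewrite card_ord.
  by rewrite -s11; apply: (opt chi a).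
exists (tree_of psi).
  split=> [|L' /linear_binary_treeP[chi chiA ->]].
    by apply/linear_binary_treeP; exists psi.
  by rewrite !beta_reassemblingE // leq_add2l psi_opt.
(* The members in the order of the output rows: first the [n] singletons, then the prefixes of sizes
   2 to [n]. *)
pose F := [seq [set v] | v <- enum 'I_n] ++
          [seq prefix_set psi k | k <- iota 2 (n - 1)].
have sF : size F = n + (n - 1).
  by rewrite size_cat size_map size_enum_ord size_map size_iota.
have FL : F =i tree_of psi.
  move=> X; rewrite mem_cat inE; congr (_ || _).
    by apply/mapP/imsetP => -[v _ ->]; exists v; rewrite ?mem_enum.
  apply/mapP/imsetP => [[k]|[k]].
    rewrite mem_iota => kn ->.
    have kT : k < #|'I_n|.+1 by rewrite card_ord; lia.
    by exists (Ordinal kT) => //; rewrite inE /=; lia.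
  rewrite inE => k2 ->; exists (val k) => //; rewrite mem_iota.
  have kn : val k < n.+1 by have := ltn_ord k; rewrite [X in _ < X.+1]card_ord.
  by move: k2 kn => /=; lia.
exists F; split=> //.
  by apply/card_uniqP; rewrite (eq_card FL) card_tree_of // sF; lia.
move=> i v; rewrite sF => iF; rewrite tab5 //; last by lia.
rewrite /row nth_cat size_map size_enum_ord; have [ilt|ige] := ltnP i n.
  rewrite (nth_map v) ?size_enum_ord //=.
  by rewrite inE orbF (nth_ord_enum v (Ordinal ilt)) eq_sym -(inj_eq val_inj).
rewrite (nth_map 0) ?size_iota ?nth_iota; try lia.
by rewrite inE /= psi_tab addnC.
Qed.

(** For a fixed program, [cost] is polynomial in the bound [B n], so a polynomial bound on loops and
    oracle calls suffices. *)
Lemma runs_poly_time_reducible (P Q : problem) c B : poly B ->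
  (forall O, solves O Q -> forall n (G : sgraph 'I_n),
     runs O (B n) c (initial_state G) (fun s => P n G (tabs s 1))) ->
  poly_time_reducible P Q.
Proof.
move=> pB cP; have [k ck] := poly_bound (poly_cost c pB).
exists c, k => O solO n G; have [t [s [ex tB Ps]]] := cP O solO n G.
by exists t, s; split=> //; apply: leq_trans tB (ck n).
Qed.

Theorem theorem5p14 :
  poly_time_reducible optimal_arrangement_problem optimal_reassembling_problem
  /\
  poly_time_reducible optimal_reassembling_problem optimal_arrangement_problem.
Proof.
split.
  apply: (@runs_poly_time_reducible _ _ arrangement_program (fun n => 4 * n + 2)).
    exact: poly_add (poly_mul (poly_const 4) poly_id) (poly_const 2).
  by move=> O solO n G; apply: arrangement_program_correct.
apply: (@runs_poly_time_reducible _ _ reassembling_program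
          (fun n => n + clique_size n)).
  have pS : poly succn := poly_add (poly_const 1) poly_id.
  exact: poly_add poly_id (poly_mul pS (poly_mul pS pS)).
by move=> O solO n G; apply: reassembling_program_correct.
Qed.
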